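(* Let $V\in\mathcal C^{1,1}(\mathbb T)$. If $\beta\min_{\mathbb T}\mu_\beta^V\to\infty$ as $\beta\to\infty$, then for any (real-valued) $\psi\in\mathsf H^2(\mathbb T)$, $$\lim_{\beta\to\infty}\beta\,\sigma_\beta^V(\psi)^2=\|\psi\|_{\mathsf H^{1/2}}^2 .$$ If one assumes instead that $\beta\min_{\mathbb T}\mu_\beta^{\beta V}\to\infty$ as $\beta\to\infty$, then for any $\psi\in\mathsf H^2(\mathbb T)$, $$\lim_{\beta\to\infty}\beta\,\sigma_\beta^{\beta V}(\psi)^2=\|\psi\|_{\mathsf H^{1/2}}^2 .$$
   Context: $\mathbb T=[-\pi,\pi]\simeq\mathbb R/2\pi\mathbb Z$ with metric $(x,y)\mapsto|e^{ix}-e^{iy}|$; $\mathcal C^{1,1}(\mathbb T)$: differentiable functions with Lipschitz derivative; $\mathsf H^m(\mathbb T)$: Sobolev space of $L^2$ functions whose first $m$ distributional derivatives are in $L^2$. With $\hat\psi_k=\int_{\mathbb T}\psi(x)e^{-ikx}\frac{dx}{2\pi}$, $\|\psi\|_{\mathsf H^{1/2}}^2=2\sum_{k\ge1}k|\hat\psi_k|^2$. For a potential $W$ on $\mathbb T$ (here $W=V$ or $W=\beta V$) and $\beta>0$, $\mu_\beta^W$ is the unique minimizer over probability measures $\mu$ on $\mathbb T$ of $F_\beta^W(\mu)=\beta\mathcal E(\mu)+\mathcal K(\mu|\mu_0^W)$, where $\mathcal E(\mu)=\iint\log|\sin(\frac{x-y}2)|^{-1}\mu(dx)\mu(dy)$,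 $\mu_0^W(dx)=e^{-W(x)}\frac{dx}{2\pi}$, and $\mathcal K(\mu|\nu)=\int\log\frac{d\mu}{d\nu}\,d\mu$ ($+\infty$ if $\mu\not\ll\nu$). Adding a constant to $W$ (e.g. to make $\mu_0^W$ a probability measure) does not change $\mu_\beta^W$. $\mu_\beta^W(x)$ denotes the density of $\mu_\beta^W$ with respect to $dx$. Let $H\psi(x)=-\mathrm{p.v.}\int_{\mathbb T}\frac{\psi(t)}{\tan(\frac{x-t}2)}\frac{dt}{2\pi}$ and $-\mathscr L\phi=\phi''+2\pi\beta H(\mu_\beta^W\phi')+(\log\mu_\beta^W)'\phi'$, regarded as a positive operator on the Hilbert space $\mathsf H=\{\psi\in L^2(\mathbb T):\psi'\in L^2(\mathbb T),\int\psi\,d\mu_\beta^W=0\}$ of real-valued functions with inner product $\langle\phi,\psi\rangle_{\mathsf H}=\int\phi'\psi'\,d\mu_\beta^W$, with inverse $\mathscr L^{-1}$ on $\mathsf H$. Then $\sigma_\beta^W(\psi)^2:=\langle\bar\psi,\mathscr L^{-1}\bar\psi\rangle_{\mathsf H}$ with $\bar\psi=\psi-\int\psi\,d\mu_\beta^W$. *)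

(* Defs.v *)
From HB Require Import structures.
From mathcomp Require Import all_boot all_order all_algebra.
From mathcomp Require Import all_classical all_reals all_analysis.
From mathcomp Require Import measurable_realfun.

Set Implicit Arguments.
Unset Strict Implicit.
Unset Printing Implicit Defensive.

Import Order.TTheory GRing.Theory Num.Theory.
Import numFieldNormedType.Exports.

Local Open Scope classical_set_scope.
Local Open Scope ring_scope.

Section circle.
Context {R : realType}.
Implicit Types (x y : R) (f g : R -> R).

(* The torus R/2piZ is represented by the fundamental domain ]-pi, pi], so that
   each of its points has exactly one representative. *)
Definition circle : set R := `]- pi, pi].

(* |e^{ix} - e^{iy}| *)
Definition circle_dist x y : R :=
  Num.sqrt ((cos x - cos y) ^+ 2 + (sin x - sin y) ^+ 2).

Definition periodic2pi f := forall x, f (x + 2 * pi) = f x.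

Definition C11 f := [/\ periodic2pi f, (forall x, derivable f x 1) &
  exists K : R, forall x y, `|(f^`())%classic x - (f^`())%classic y| <= K * circle_dist x y].

(* The minimum over the torus when f is continuous and 2pi-periodic. *)
Definition circle_min f : R := inf (f @` circle).

Definition smooth_periodic f :=
  periodic2pi f /\ forall n x, derivable (f^`(n))%classic x 1.

(* Functions on the torus are considered up to a.e. equality on [circle]; their
   values outside of [circle] play no role in the next three definitions. *)
Definition L2_circle f := measurable_fun circle f /\
  lebesgue_measure.-integrable circle (fun x => (f x ^+ 2)%:E).

Definition weak_derivative f g := forall eta, smooth_periodic eta ->
  \int[lebesgue_measure]_(x in circle) (f x * (eta^`())%classic x) =
  - \int[lebesgue_measure]_(x in circle) (g x * eta x).

(* d k is the k-th distributional derivative of f. *)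
Definition sobolev (m : nat) f := exists d : nat -> R -> R,
  [/\ d 0%N = f, (forall k, (k <= m)%N -> L2_circle (d k)) &
    forall k, (k < m)%N -> weak_derivative (d k) (d k.+1)].

(* The k-th Fourier coefficient is fourier_re f k + i * fourier_im f k. *)
Definition fourier_re f (k : nat) : R :=
  \int[lebesgue_measure]_(x in circle) (f x * cos (k%:R * x) / (2 * pi)).
Definition fourier_im f (k : nat) : R :=
  - \int[lebesgue_measure]_(x in circle) (f x * sin (k%:R * x) / (2 * pi)).

Definition sobolev_half_sqnorm f : \bar R := (2%:E *
  \sum_(1 <= k <oo) (k%:R * (fourier_re f k ^+ 2 + fourier_im f k ^+ 2))%:E)%E.

(* The principal value at t = x excises a neighbourhood of x for the metric of
   the torus. *)
Definition hilbert_transform f x : R :=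
  - lim ((\int[lebesgue_measure]_(t in circle `&` [set t | e < circle_dist x t])
            (f t / tan ((x - t) / 2) / (2 * pi))) @[e --> (0 : R)^'+]).

End circle.

Section reference_measure.
Context {R : realType}.
Variable W : R -> R.

(* The test makes this density measurable for every W, so that [ref_measure] is
   always a measure; it is void for the continuous potentials of interest. *)
Definition ref_density (x : R) : R :=
  if `[< measurable_fun [set: R] W >] then expR (- W x) / (2 * pi) else 0.

Lemma measurable_ref_density : measurable_fun [set: R] ref_density.
Proof.
rewrite /ref_density; case: asboolP => [mW|_]; last exact: measurable_cst.
apply: measurable_funM => //; apply: measurableT_comp => //.
exact: measurableT_comp.
Qed.

Lemma ref_density_ge0 x : 0 <= ref_density x.
Proof.
rewrite /ref_density; case: ifP => // _.
by rewrite mulr_ge0 ?expR_ge0// invr_ge0 mulr_ge0// pi_ge0.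
Qed.

Definition ref_measure (A : set (measurableTypeR R)) : \bar R :=
  (\int[lebesgue_measure]_(x in A `&` circle) (ref_density x)%:E)%E.

Let ref_measure0 : ref_measure set0 = 0%E.
Proof. by rewrite /ref_measure set0I integral_set0. Qed.

Let ref_measure_ge0 A : (0 <= ref_measure A)%E.
Proof. by apply: integral_ge0 => x _; rewrite lee_fin ref_density_ge0. Qed.

Let ref_measure_sigma_additive : semi_sigma_additive ref_measure.
Proof.
move=> F mF tF mUF; rewrite /ref_measure setI_bigcupl.
rewrite ge0_integral_bigcup//=.
- by apply: is_cvg_ereal_nneg_natsum_cond => n _ _; exact: ref_measure_ge0.
- by move=> n; apply: measurableI => //; exact: measurable_itv.
- apply: measurable_funTS; apply/measurable_EFinP.
  exact: measurable_ref_density.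
- by move=> x _; rewrite lee_fin ref_density_ge0.
- exact: trivIset_setIr.
Qed.

HB.instance Definition _ := isMeasure.Build _ _ _ ref_measure
  ref_measure0 ref_measure_ge0 ref_measure_sigma_additive.

Let ref_measure_sigma_finite : sigma_finite setT ref_measure.
Proof.
exists (fun n => [set x | ref_density x <= n%:R]).
  apply/esym; rewrite -subTset => x _; exists (Num.truncn (ref_density x)).+1 => //=.
  by rewrite ltW// truncnS_gt.
move=> n.
have mF : measurable [set x : measurableTypeR R | ref_density x <= n%:R].
  rewrite -[X in measurable X]setTI.
  have -> : [set x | ref_density x <= n%:R] = ref_density @^-1` `]-oo, n%:R].
    by apply/seteqP; split=> x /=; rewrite in_itv.
  by apply: measurable_ref_density => //; exact: measurable_itv.
split=> //.
have mFc : measurable ([set x : measurableTypeR R | ref_density x <= n%:R] `&` circle).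
  by apply: measurableI => //; exact: measurable_itv.
have le_n : (ref_measure [set x | (ref_density x <= n%:R)%R] <=
    \int[lebesgue_measure]_(x in
       [set x : measurableTypeR R | (ref_density x <= n%:R)%R] `&` circle)
      n%:R%:E)%E.
  apply: ge0_le_integral => //.
  - by move=> x _; rewrite lee_fin ref_density_ge0.
  - by apply: measurable_funTS; apply/measurable_EFinP; exact: measurable_ref_density.
  - by move=> x [].
apply: (le_lt_trans le_n); rewrite integral_cst//=.
have le_c : (n%:R%:E * lebesgue_measure
    ([set x : measurableTypeR R | (ref_density x <= n%:R)%R] `&` circle) <=
    n%:R%:E * lebesgue_measure (@circle R))%E.
  apply: lee_wpmul2l; first by rewrite lee_fin.
  by apply: le_measure; rewrite ?inE//; exact: measurable_itv.
apply: (le_lt_trans le_c); rewrite /circle lebesgue_measure_itv/=; case: ifPn => _.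
  by rewrite -EFinB -EFinM ltry.
by rewrite mule0 ltry.
Qed.

HB.instance Definition _ := Measure_isSigmaFinite.Build _ _ _ ref_measure
  ref_measure_sigma_finite.

End reference_measure.

Section equilibrium.
Context {R : realType}.
Local Notation prob := (probability (measurableTypeR R) R).
Local Open Scope ereal_scope.
Local Open Scope charge_scope.

(* lne 0 = -oo, so that the kernel is +oo on the diagonal. *)
Definition log_energy (mu : prob) : \bar R :=
  \int[mu]_x \int[mu]_y (- lne `|sin ((x - y) / 2)|%:E).

Definition relative_entropy (mu : prob)
    (nu : {sigma_finite_measure set (measurableTypeR R) -> \bar R}) : \bar R :=
  if `[< mu `<< nu >]
  then \int[mu]_x lne (('d (charge_of_finite_measure mu) '/d nu) x)
  else +oo.

Definition free_energy (beta : R) (W : R -> R) (mu : prob) : \bar R :=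
  beta%:E * log_energy mu + relative_entropy mu (ref_measure W).

Definition on_circle (mu : prob) := mu (~` circle) = 0.

Definition is_equilibrium (beta : R) (W : R -> R) (mu : prob) :=
  on_circle mu /\
  forall nu : prob, on_circle nu ->
    free_energy beta W mu <= free_energy beta W nu.

Definition is_density (mu : prob) (rho : R -> R) :=
  [/\ continuous rho, periodic2pi rho & forall A, measurable A ->
    mu A = \int[lebesgue_measure]_(x in A `&` circle) (rho x)%:E].

End equilibrium.

Section generator.
Context {R : realType}.
Variables (beta : R) (mu : probability (measurableTypeR R) R) (rho : R -> R).

Definition centered (f : R -> R) : R -> R :=
  fun x => f x - \int[mu]_(y in circle) f y.

Definition Hspace (f : R -> R) :=
  sobolev 1 f /\ \int[mu]_(x in circle) f x = 0.

(* s is the inner product of f and g in H *)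
Definition Hinner (f g : R -> R) (s : R) := exists f1 g1 : R -> R,
  [/\ L2_circle f1, L2_circle g1, weak_derivative f f1, weak_derivative g g1 &
    s = \int[mu]_(x in circle) (f1 x * g1 x)].

(* L phi, where phi1, phi2 and l1 stand for phi', phi'' and (log rho)' *)
Definition generator (phi1 phi2 l1 : R -> R) : R -> R := fun x =>
  - (phi2 x
     + 2 * pi * beta * hilbert_transform (fun t => rho t * phi1 t) x
     + l1 x * phi1 x).

(* phi = L^-1 f in H. The inner product of H only sees functions modulo
   constants, each class being represented by its element of mean zero: L phi
   is the mean-zero representative of the differential expression, whose own
   mean need not vanish. *)
Definition Linverse (f phi : R -> R) :=
  [/\ Hspace f, Hspace phi & exists phi1 phi2 l1 : R -> R,
    [/\ L2_circle phi1 /\ weak_derivative phi phi1,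
        L2_circle phi2 /\ weak_derivative phi1 phi2,
        L2_circle l1 /\ weak_derivative (fun x => ln (rho x)) l1 &
        {ae lebesgue_measure, forall x, circle x ->
           centered (generator phi1 phi2 l1) x = f x}]].

Definition is_sigma2 (psi : R -> R) (s : R) := exists phi : R -> R,
  Linverse (centered psi) phi /\ Hinner (centered psi) phi s.

End generator.

(* Main.v *)
From HB Require Import structures.
Require Import Defs.
From mathcomp Require Import all_boot all_order all_algebra.
From mathcomp Require Import all_classical all_reals all_analysis.
From mathcomp Require Import measurable_realfun ring lra.

(** Write phi = L^-1 psi and u = rho phi', where rho is the density of mu. Then
   sigma^2 = \int psi' u, and multiplication by rho turns the equation
   L phi = psi (modulo constants) into one for u alone:

     u' / rho + 2 pi beta H u = - psi + c.

   If the first term were absent, u would be H psi / (2 pi beta) up to a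
   constant, because H^2 = -1 on functions of mean zero, and beta sigma^2 would
   be exactly the squared H^(1/2) norm N of psi. Two tests of the equation show
   that the first term is negligible when beta min rho is large.

   - Against u': as \int u' H u is a nonnegative quadratic form (2 pi times the
     sum of |k| |u_k|^2), \int u'^2 / rho <= \int psi' u = sigma^2
     ([weighted_energy_le]).
   - Against H psi': as H is antisymmetric,
     2 pi (beta sigma^2 - N) = - \int H psi' (u' / rho), and Cauchy-Schwarz bounds
     the square of the right-hand side by \int psi'^2 / min rho times sigma^2
     ([partial_estimate], [variance_estimate]).

   Thus X = beta sigma^2 satisfies (X - N)^2 <= K X / (beta min rho), with K
   depending only on psi, which forces X to converge to N ([variance_cvg]).

   The function H psi' is only used through trigonometric polynomials: the
   second test is performed with the partial Fourier sums of psi', and the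
   identities for H u are obtained by approximating u by its partial Fourier
   sums. The function u has a square integrable derivative, hence is Hoelder
   continuous of exponent 1/2. This makes (u t - u x) / tan ((x - t) / 2)
   integrable in t, which gives at once the existence of the principal value
   ([hilbert_transformE]), the pointwise convergence of Fourier series by Dini's
   criterion ([fourier_sum_cvg]), and a bound for H u that depends only on the
   energy of u', so that dominated convergence applies to the conjugates of the
   partial sums ([conjugate_inner_cvg]). Weak derivatives are brought to this
   setting by the uniqueness of Fourier coefficients ([fourier_uniqueness],
   [weak_derivative_primitive]). *)

Set Implicit Arguments.
Unset Strict Implicit.
Unset Printing Implicit Defensive.
Import Order.TTheory GRing.Theory Num.Theory.
Import numFieldNormedType.Exports.
Local Open Scope classical_set_scope.
Local Open Scope ring_scope.

(** * Square integrable functions *)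

Section square_integrable.
Context d (T : measurableType d) (R : realType).
Variables (mu : {measure set T -> \bar R}) (D : set T).
Hypotheses (mD : measurable D) (fD : (mu D < +oo)%E).
Implicit Types (f g : T -> R).

Local Notation itg f := (mu.-integrable D (EFin \o f)).
Local Notation I f := (\int[mu]_(x in D) f x).

(** On the torus, with Lebesgue measure, this is [L2_circle]. *)
Definition sqint f :=
  measurable_fun D f /\ mu.-integrable D (fun x => (f x ^+ 2)%:E).

Lemma itg_meas f : itg f -> measurable_fun D f.
Proof. by move=> /integrableP[/measurable_EFinP]. Qed.

Lemma itg_le f g : measurable_fun D f -> (forall x, D x -> `|f x| <= g x) ->
  itg g -> itg f.
Proof.
move=> mf fg ig; apply: le_integrable ig => //; first exact/measurable_EFinP.
by move=> x Dx /=; rewrite lee_fin (le_trans (fg x Dx))// ler_norm.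
Qed.

Lemma itg_bnd (M : R) f : measurable_fun D f -> (forall x, D x -> `|f x| <= M) ->
  itg f.
Proof.
move=> mf fM; apply: measurable_bounded_integrable => //.
exists M; split; first by rewrite num_real.
by move=> N MN x Dx /=; rewrite (le_trans (fM _ Dx))// ltW.
Qed.

Lemma itg_cst (c : R) : itg (fun=> c).
Proof. by apply: (@itg_bnd `|c|). Qed.

Lemma itgD f g : itg f -> itg g -> itg (fun x => f x + g x).
Proof. by move=> fi gi; have := integrableD mD fi gi. Qed.

Lemma itgN f : itg f -> itg (fun x => - f x).
Proof. by move=> fi; have := integrableN fi. Qed.

Lemma itgB f g : itg f -> itg g -> itg (fun x => f x - g x).
Proof. by move=> fi gi; apply: itgD => //; exact: itgN. Qed.

Lemma itgZ (c : R) f : itg f -> itg (fun x => c * f x).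
Proof. by move=> fi; have := integrableZl mD c fi. Qed.

Lemma itg_abs f : itg f -> itg (fun x => `|f x|).
Proof. by move=> fi; have := integrable_norm fi. Qed.

Lemma sqint_meas f : sqint f -> measurable_fun D f. Proof. by case. Qed.

Lemma sqint_itgM f g : sqint f -> sqint g -> itg (fun x => f x * g x).
Proof.
move=> [mf f2] [mg g2]; apply: (@itg_le _ (fun x => f x ^+ 2 + g x ^+ 2)).
- exact: measurable_funM.
- move=> x _; rewrite ler_norml; apply/andP; split.
    by have := sqr_ge0 (f x + g x); have := sqr_ge0 (f x); have := sqr_ge0 (g x); nra.
  by have := sqr_ge0 (f x - g x); have := sqr_ge0 (f x); have := sqr_ge0 (g x); nra.
- exact: itgD.
Qed.

Lemma sqint_bnd (M : R) f : measurable_fun D f ->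
  (forall x, D x -> `|f x| <= M) -> sqint f.
Proof.
move=> mf fM; split => //; apply: (@itg_bnd (M ^+ 2)).
  exact: measurable_funX.
by move=> x Dx; rewrite normrX lerXn2r ?nnegrE// ?fM// (le_trans _ (fM _ Dx)).
Qed.

Lemma sqint_cst (c : R) : sqint (fun=> c).
Proof. by apply: (@sqint_bnd `|c|). Qed.

Lemma sqint_itg f : sqint f -> itg f.
Proof.
move=> /sqint_itgM /(_ (sqint_cst 1)).
by under eq_fun do rewrite mulr1.
Qed.

Lemma sqintD f g : sqint f -> sqint g -> sqint (fun x => f x + g x).
Proof.
move=> sf sg; split; first by apply: measurable_funD; [case: sf|case: sg].
have -> : (fun x => ((f x + g x) ^+ 2)%:E) =
    EFin \o (fun x => f x ^+ 2 + (2 * (f x * g x) + g x ^+ 2)).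
  by apply/funext => x /=; congr EFin; ring.
apply: itgD; first by case: sf.
by apply: itgD; [apply: itgZ; exact: sqint_itgM|case: sg].
Qed.

Lemma sqintMb (M : R) f g : sqint f -> measurable_fun D g ->
  (forall x, D x -> `|g x| <= M) -> sqint (fun x => f x * g x).
Proof.
move=> sf mg gM; split; first by apply: measurable_funM => //; case: sf.
apply: (@itg_le _ (fun x => M ^+ 2 * f x ^+ 2)).
- by apply: measurable_funX; apply: measurable_funM => //; case: sf.
- move=> x Dx; rewrite normrX normrM exprMn mulrC (@real_normK _ (f x)) ?num_real//.
  by rewrite ler_wpM2r ?sqr_ge0// lerXn2r ?nnegrE ?gM// (le_trans _ (gM _ Dx)).
- by apply: itgZ; case: sf.
Qed.

Lemma sqintZ (c : R) f : sqint f -> sqint (fun x => c * f x).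
Proof.
move=> sf; under eq_fun do rewrite mulrC.
exact: (@sqintMb `|c|).
Qed.

Lemma sqintN f : sqint f -> sqint (fun x => - f x).
Proof. by move=> /(sqintZ (-1)); under eq_fun do rewrite mulN1r. Qed.

Lemma sqintB f g : sqint f -> sqint g -> sqint (fun x => f x - g x).
Proof. by move=> sf sg; apply: sqintD => //; exact: sqintN. Qed.

Lemma itg_sum (F : nat -> T -> R) m n : (forall k, itg (F k)) ->
  itg (fun x => \sum_(m <= k < n) F k x).
Proof.
move=> iF; elim: n => [|n IH].
  by under eq_fun do rewrite big_geq//; exact: itg_cst.
have [mn|mn] := leqP m n.
  by under eq_fun do rewrite big_nat_recr//=; exact: itgD.
by under eq_fun do rewrite big_geq//; exact: itg_cst.
Qed.

Lemma sqint_sum (F : nat -> T -> R) m n : (forall k, sqint (F k)) ->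
  sqint (fun x => \sum_(m <= k < n) F k x).
Proof.
move=> iF; elim: n => [|n IH].
  by under eq_fun do rewrite big_geq//; exact: sqint_cst.
have [mn|mn] := leqP m n.
  by under eq_fun do rewrite big_nat_recr//=; exact: sqintD.
by under eq_fun do rewrite big_geq//; exact: sqint_cst.
Qed.

Lemma Rint_sum (F : nat -> T -> R) m n : (forall k, itg (F k)) ->
  I (fun x => \sum_(m <= k < n) F k x) = \sum_(m <= k < n) I (F k).
Proof.
move=> iF; elim: n => [|n IH].
  rewrite big_geq//; under eq_Rintegral do rewrite big_geq//.
  by rewrite Rintegral_cst// mul0r.
have [mn|mn] := leqP m n.
  rewrite big_nat_recr//= -IH -RintegralD//; last exact: itg_sum.
  by apply: eq_Rintegral => x _; rewrite big_nat_recr.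
rewrite big_geq//; under eq_Rintegral do rewrite big_geq//.
by rewrite Rintegral_cst// mul0r.
Qed.

Lemma Rint_sqr_ge0 f : 0 <= I (fun x => f x ^+ 2).
Proof. by apply: Rintegral_ge0 => x _; exact: sqr_ge0. Qed.

(** The polynomial t |-> \int (f + t g)^2 is nonnegative, so that its
   discriminant is not positive. *)
Lemma cauchy_schwarz f g : sqint f -> sqint g ->
  I (fun x => f x * g x) ^+ 2 <= I (fun x => f x ^+ 2) * I (fun x => g x ^+ 2).
Proof.
move=> sf sg.
set a := I (fun x => f x ^+ 2); set b := I (fun x => f x * g x).
set c := I (fun x => g x ^+ 2).
have P t : 0 <= a + 2 * t * b + t ^+ 2 * c.
  have := Rint_sqr_ge0 (fun x => f x + t * g x).
  have -> : I (fun x => (f x + t * g x) ^+ 2) =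
      I (fun x => f x ^+ 2 + (2 * t * (f x * g x) + t ^+ 2 * g x ^+ 2)).
    by apply: eq_Rintegral => x _; ring.
  have ifg := sqint_itgM sf sg; case: sf => _ f2; case: sg => _ g2.
  rewrite RintegralD//; last by apply: itgD; apply: itgZ.
  by rewrite RintegralD// ?RintegralZl ?addrA//; exact: itgZ.
have a0 : 0 <= a by exact: Rint_sqr_ge0.
have c0 : 0 <= c by exact: Rint_sqr_ge0.
move: a0 c0 P; move: a b c => a b c a0 c0 P.
have [c00|c00] := eqVneq c 0.
  rewrite c00 mulr0.
  have [->|b0] := eqVneq b 0; first by rewrite expr0n.
  have := P (- (a + 1) / (2 * b)); rewrite c00.
  have -> : a + 2 * (- (a + 1) / (2 * b)) * b + (- (a + 1) / (2 * b)) ^+ 2 * 0 = -1.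
    by field.
  by rewrite lerNr oppr0 leNgt ltr01.
have := P (- b / c).
have -> : a + 2 * (- b / c) * b + (- b / c) ^+ 2 * c = (a * c - b ^+ 2) / c by field.
by rewrite pmulr_lge0 ?invr_gt0 ?lt_def ?c00// subr_ge0.
Qed.

Lemma Rint_ae f g : measurable_fun D f -> measurable_fun D g ->
  {ae mu, forall x, D x -> f x = g x} -> I f = I g.
Proof.
move=> mf mg fg; congr fine; apply: ae_eq_integral => //.
- exact/measurable_EFinP.
- exact/measurable_EFinP.
- by apply: filterS fg => x h Dx; rewrite h.
Qed.

Lemma Rint_dominated (F : nat -> T -> R) f h :
  (forall n, measurable_fun D (F n)) ->
  (forall x, D x -> F n x @[n --> \oo] --> f x) ->
  itg h -> (forall n x, D x -> `|F n x| <= h x) ->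
  itg f /\ I (F n) @[n --> \oo] --> I f.
Proof.
move=> mF Ff ih Fh.
have mf : measurable_fun D f by apply: measurable_fun_cvg Ff.
have H1 n : measurable_fun D (EFin \o F n) by exact/measurable_EFinP.
have H2 : measurable_fun D (EFin \o f) by exact/measurable_EFinP.
have H3 : {ae mu, forall x, D x -> (EFin \o F n) x @[n --> \oo] --> (EFin \o f) x}.
  by apply/aeW => x Dx; apply: cvg_EFin; [near=> n|exact: Ff].
have H4 : {ae mu, forall x n, D x -> (`|(EFin \o F n) x| <= (EFin \o h) x)%E}.
  by apply/aeW => x n Dx /=; rewrite lee_fin Fh.
have [fi _ cI] := dominated_convergence mD H1 H2 H3 ih H4.
split=> //.
apply: fine_cvg; rewrite fineK//; exact: integrable_fin_num.
Unshelve. all: by end_near. Qed.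

End square_integrable.

(** * Integration of periodic functions over the torus *)

Section circle_integral.
Context {R : realType}.
Local Notation lam := (@lebesgue_measure R).
Local Notation C := (@circle R).
Implicit Types (f g : R -> R).

Lemma measurable_circle : measurable (C : set (measurableTypeR R)). Proof. exact: measurable_itv. Qed.

Lemma circle_measure : lam C = (2 * pi)%:E.
Proof.
rewrite /circle lebesgue_measure_itv/= lte_fin ifT; last first.
  by have := @pi_gt0 R; lra.
by rewrite -EFinD; congr EFin; ring.
Qed.

Lemma circle_fin : (lam C < +oo)%E.
Proof. by rewrite circle_measure ltry. Qed.

Lemma Rint_circle_cst (c : R) : \int[lam]_(x in C) c = c * (2 * pi).
Proof.
rewrite Rintegral_cst; last exact: measurable_circle.
by rewrite [fine _]/= circle_measure.
Qed.

Let reflection (x t : measurableTypeR R) : measurableTypeR R := x - t.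

Let measurable_reflection x : measurable_fun setT (reflection x).
Proof. by apply: measurable_funB => //; exact: measurable_id. Qed.

HB.instance Definition _ x :=
  isMeasurableFun.Build _ _ _ _ (reflection x) (measurable_reflection x).

Lemma lebesgue_measure_reflection (x : R) (A : set R) : measurable A ->
  pushforward lam (reflection x) A = lam A.
Proof.
move=> mA; apply/esym/lebesgue_measure_unique => //= _ [[a b]] _ <-.
rewrite /pushforward/=.
have -> : reflection x @^-1` `]a, b] = `[x - b, x - a[%classic.
  by apply/seteqP; split=> t /=; rewrite !in_itv/= /reflection => /andP[h1 h2];
    apply/andP; split; lra.
rewrite !lebesgue_measure_itv/= !lte_fin.
have -> : (x - b < x - a) = (a < b) by apply/idP/idP; lra.
case: ifP => // _.
by rewrite -!EFinD; congr EFin; ring.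
Qed.

Lemma ge0_integral_reflection (x : R) (D : set R) (f : R -> \bar R) :
  measurable D -> measurable_fun setT f -> (forall y, 0 <= f y)%E ->
  (\int[lam]_(t in [set t | D (x - t)%R]) f (x - t)%R = \int[lam]_(t in D) f t)%E.
Proof.
move=> mD mf f0.
have := @ge0_integral_pushforward _ _ _ _ R _ (@measurable_reflection x) lam D f mD (measurable_funTS mf)
  (fun y _ => f0 y).
move=> <-; apply: eq_measure_integral => //= A mA AD.
exact: lebesgue_measure_reflection.
Qed.

Lemma ge0_integral_translation (c : R) (D : set R) (f : R -> \bar R) :
  measurable D -> measurable_fun setT f -> (forall y, 0 <= f y)%E ->
  (\int[lam]_(t in [set t | D (t + c)%R]) f (t + c)%R = \int[lam]_(t in D) f t)%E.
Proof.
move=> mD mf f0.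
have mr : measurable_fun setT (fun t : R => c - t : R).
  by apply: measurable_funB => //; exact: measurable_id.
rewrite -(@ge0_integral_reflection c D f)//.
rewrite -(@ge0_integral_reflection 0 [set t | D (c - t)] (fun t => f (c - t)))//=.
- have -> : [set t | D (t + c)] = [set t | D (c - (0 - t))].
    by apply/seteqP; split => t /=; rewrite sub0r opprK addrC.
  by apply: eq_integral => t _; rewrite sub0r opprK addrC.
- have := mr measurableT D mD; rewrite setTI; exact.
- by move=> mT; exact: (measurableT_comp mf mr).
Qed.

(** The reflection t |-> x - t carries the fundamental domain onto
   [x - pi, x + pi[; the part of this interval that sticks out on one side is
   brought back by one period. *)
Lemma ge0_integral_periodic (x : R) (f : R -> \bar R) : x \in `]- pi, pi] ->
  measurable_fun setT f -> (forall y, 0 <= f y)%E ->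
  (forall y, f (y + 2 * pi) = f y) ->
  (\int[lam]_(t in C) f (x - t)%R = \int[lam]_(t in C) f t)%E.
Proof.
rewrite in_itv/= => /andP[x1 x2] mf f0 fp; have pi0 := @pi_gt0 R.
have mf' D : measurable_fun D f by exact: measurable_funTS.
have -> : (\int[lam]_(t in C) f (x - t)%R =
    \int[lam]_(t in `[(x - pi)%R, (x + pi)%R[%classic) f t)%E.
  rewrite -(@ge0_integral_reflection x _ f)//.
  congr (integral _ _ _); rewrite /circle; apply/seteqP; split=> t /=; rewrite !in_itv/= =>
    /andP[? ?]; apply/andP; split; lra.
have [x0|x0] := ltP 0 x.
- have -> : `[(x - pi)%R, (x + pi)%R[%classic =
      `[(x - pi)%R, pi]%classic `|` `]pi, (x + pi)%R[%classic.
    apply/seteqP; split=> t /=; rewrite !in_itv/=.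
      by move=> /andP[? ?]; have [?|?] := leP t pi; [left|right]; apply/andP; split; lra.
    by move=> [|] /andP[? ?]; apply/andP; split; lra.
  rewrite ge0_integral_setU//=; [|exact: mf'|]; last first.
    apply/disj_setPS => t /=; rewrite !in_itv/= => -[/andP[? ?] /andP[? ?]]; lra.
  have -> : (\int[lam]_(t in `]pi, (x + pi)%R[%classic) f t =
             \int[lam]_(t in `](- pi)%R, (x - pi)%R[%classic) f t)%E.
    rewrite -(@ge0_integral_translation (2 * pi))//.
    rewrite (_ : [set t | _] = `](- pi)%R, (x - pi)%R[%classic).
      by apply: eq_integral => t _; rewrite fp.
    by apply/seteqP; split=> t /=; rewrite !in_itv/= => /andP[? ?]; apply/andP; split; lra.
  have -> : C = `](- pi), (x - pi)[%classic `|` `[(x - pi), pi]%classic.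
    rewrite /circle; apply/seteqP; split=> t /=; rewrite !in_itv/=.
      by move=> /andP[? ?]; have [?|?] := ltP t (x - pi); [left|right]; apply/andP; split; lra.
    by move=> [|] /andP[? ?]; apply/andP; split; lra.
  rewrite ge0_integral_setU//=; [|exact: mf'|]; last first.
    apply/disj_setPS => t /=; rewrite !in_itv/= => -[/andP[? ?] /andP[? ?]]; lra.
  by rewrite addeC.
- have -> : `[(x - pi)%R, (x + pi)%R[%classic =
      `[(x - pi)%R, (- pi)]%classic `|` `](- pi), (x + pi)%R[%classic.
    apply/seteqP; split=> t /=; rewrite !in_itv/=.
      by move=> /andP[? ?]; have [?|?] := leP t (- pi); [left|right]; apply/andP; split; lra.
    by move=> [|] /andP[? ?]; apply/andP; split; lra.
  rewrite ge0_integral_setU//=; [|exact: mf'|]; last first.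
    apply/disj_setPS => t /=; rewrite !in_itv/= => -[/andP[? ?] /andP[? ?]]; lra.
  have -> : (\int[lam]_(t in `[(x - pi)%R, (- pi)%R]%classic) f t =
             \int[lam]_(t in `[(x + pi)%R, pi]%classic) f t)%E.
    apply/esym; rewrite -(@ge0_integral_translation (2 * pi))//.
    rewrite (_ : [set t | `[x + pi, pi]%classic (t + 2 * pi)] = `[(x - pi)%R, (- pi)]%classic).
      by apply: eq_integral => t _; rewrite fp.
    by apply/seteqP; split=> t /=; rewrite !in_itv/= => /andP[? ?]; apply/andP; split; lra.
  have -> : C = `](- pi), (x + pi)[%classic `|` `[(x + pi), pi]%classic.
    rewrite /circle; apply/seteqP; split=> t /=; rewrite !in_itv/=.
      by move=> /andP[? ?]; have [?|?] := ltP t (x + pi); [left|right]; apply/andP; split; lra.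
    by move=> [|] /andP[? ?]; apply/andP; split; lra.
  rewrite ge0_integral_setU//=; [|exact: mf'|]; last first.
    apply/disj_setPS => t /=; rewrite !in_itv/= => -[/andP[? ?] /andP[? ?]]; lra.
  by rewrite addeC.
Qed.

(** The positive and negative parts of a periodic function are periodic, which
   reduces the claim to nonnegative functions. *)
Lemma Rint_periodic (x : R) f : x \in `]- pi, pi] -> measurable_fun setT f ->
  (forall y, f (y + 2 * pi) = f y) ->
  \int[lam]_(t in C) f (x - t) = \int[lam]_(t in C) f t.
Proof.
move=> xC mf fp; congr fine.
have mf' : measurable_fun setT (EFin \o f) by exact/measurable_EFinP.
rewrite integralE [RHS]integralE; congr (_ - _)%E.
- rewrite -[RHS](@ge0_integral_periodic x (EFin \o f)^\+%E)//.
  + by apply: eq_integral => t _; rewrite !funepos.unlock.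
  + exact: measurable_funepos.
  + by move=> y; rewrite funepos.unlock/= fp.
- rewrite -[RHS](@ge0_integral_periodic x (EFin \o f)^\-%E)//.
  + by apply: eq_integral => t _; rewrite !funeneg.unlock.
  + exact: measurable_funeneg.
  + by move=> y; rewrite funeneg.unlock/= fp.
Qed.

(** The reflection t |-> - t exchanges the positive and negative parts of f. *)
Lemma Rint_odd f : measurable_fun setT f -> (forall y, f (y + 2 * pi) = f y) ->
  (forall y, f (- y) = - f y) -> \int[lam]_(t in C) f t = 0.
Proof.
move=> mf fp fo; rewrite /Rintegral integralE.
have mf' : measurable_fun setT (EFin \o f) by exact/measurable_EFinP.
have p0 : (0 : R) \in `]- pi, pi] by rewrite in_itv/= oppr_lt0 pi_gt0 pi_ge0.
have -> : (\int[lam]_(x in C) (fun y => (f y)%:E)^\+ x =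
           \int[lam]_(x in C) (fun y => (f y)%:E)^\- x)%E.
  rewrite -(@ge0_integral_periodic 0 (EFin \o f)^\+%E)//.
  - by apply: eq_integral => t _; rewrite funepos.unlock funeneg.unlock/= sub0r fo EFinN.
  - exact: measurable_funepos.
  - by move=> y; rewrite funepos.unlock/= fp.
by case: (integral _ _ _) => //= r; rewrite subrr.
Qed.

End circle_integral.

(** * An integrable singularity of order 1/2 *)

(** The identity y^-1 = y (y^2)^-1 reduces inversion to a power of a
   nonnegative function; it also holds at 0, where the inverse is 0. *)
Lemma measurable_funV d (T : measurableType d) (R : realType) (D : set T)
    (f : T -> R) :
  measurable_fun D f -> measurable_fun D (fun x => (f x)^-1).
Proof.
move=> mf.
have -> : (fun x => (f x)^-1) = (fun x => f x * (f x ^+ 2) `^ (-1)).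
  apply/funext => x; have [->|fx0] := eqVneq (f x) 0; first by rewrite invr0 mul0r.
  by rewrite powR_inv1 ?sqr_ge0//; field.
apply: measurable_funM => //.
apply: (@measurableT_comp _ _ _ _ _ _ (fun y : R => y `^ (-1))).
  exact: measurable_powR.
exact: measurable_funX.
Qed.

Section kernel.
Context {R : realType}.
Local Notation lam := (@lebesgue_measure R).
Local Notation C := (@circle R).
Implicit Types (f g : R -> R).

Lemma meas_cos (D : set R) f : measurable_fun D f ->
  measurable_fun D (fun t => cos (f t)).
Proof.
by apply: measurableT_comp; apply: continuous_measurable_fun; exact: continuous_cos.
Qed.

Lemma meas_sin (D : set R) f : measurable_fun D f ->
  measurable_fun D (fun t => sin (f t)).
Proof.
by apply: measurableT_comp; apply: continuous_measurable_fun; exact: continuous_sin.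
Qed.

Lemma cos_period (k : nat) (y : R) : cos (k%:R * (y + 2 * pi)) = cos (k%:R * y).
Proof.
have := periodicn (@cosD2pi R) k (k%:R * y); rewrite -mulr_natl => <-.
by congr cos; ring.
Qed.

Lemma sin_period (k : nat) (y : R) : sin (k%:R * (y + 2 * pi)) = sin (k%:R * y).
Proof.
have := periodicn (@sinD2pi R) k (k%:R * y); rewrite -mulr_natl => <-.
by congr sin; ring.
Qed.

Lemma sin_half_period (y : R) : sin ((y + 2 * pi) / 2) = - sin (y / 2).
Proof. by rewrite -sinDpi; congr sin; field. Qed.

(** For w in [0, pi/4] the mean value theorem gives sin w >= w cos (pi/4); then
   sin (2 w) = 2 sin w cos w >= 2 w cos (pi/4)^2 = w. *)
Lemma sin_ge_half (z : R) : 0 <= z <= pi / 2 -> z / 2 <= sin z.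
Proof.
move=> /andP[z0 z1]; have pi0 := @pi_gt0 R.
pose w := z / 2.
have w0 : 0 <= w by rewrite /w; lra.
have w1 : w <= pi / 4 by rewrite /w; lra.
have ch : forall c : R, 0 <= c <= pi / 4 -> cos (pi / 4) <= cos c.
  move=> c /andP[c0 c1].
  by rewrite le_eqVlt ltr_cos ?in_itv/=; [|lra|lra]; have [->|?] := eqVneq c (pi / 4);
    rewrite ?eqxx//; apply/orP; right; rewrite lt_neqAle c1 andbT.
have cs : cos (pi / 4) ^+ 2 = 1 / 2 :> R.
  have := cos_mulr2n (pi / 4 : R).
  rewrite (_ : pi / 4 *+ 2 = pi / 2); last by rewrite -mulr_natr; field.
  by rewrite cos_pihalf -mulr_natr => h; lra.
have c4 : 0 <= cos (pi / 4) :> R by apply: cos_ge0_pihalf; lra.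
have [c cI] : exists2 c : R, c \in `[0, w] & sin w - sin 0 = cos c * (w - 0).
  apply: MVT_segment => //.
  by apply: continuous_subspaceT => x; exact: continuous_sin.
rewrite in_itv/= in cI; rewrite sin0 !subr0 => sw.
have sw' : cos (pi / 4) * w <= sin w.
  by rewrite sw ler_wpM2r// ch//; case/andP: cI => ? ?; lra.
have cw : cos (pi / 4) <= cos w by apply: ch; lra.
have -> : z = w *+ 2 by rewrite /w -mulr_natr; field.
rewrite sin_mulr2n -mulr_natr.
have := ler_pM c4 (mulr_ge0 c4 w0) cw sw'.
by rewrite mulrA -expr2 cs -[X in _ -> _ <= X]mulr_natr => h; lra.
Qed.

Lemma norm_le_sin_half (y : R) : `|y| <= pi -> `|y| <= 4 * `|sin (y / 2)|.
Proof.
move=> yp.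
have -> : `|sin (y / 2)| = sin (`|y| / 2).
  have h : 0 <= sin (`|y| / 2).
    by apply: sin_ge0_pi; rewrite divr_ge0//=; have := normr_ge0 y; lra.
  have [y0|y0] := leP 0 y; first by rewrite (ger0_norm y0) in h *; rewrite ger0_norm.
  by rewrite (ltr0_norm y0) mulNr sinN in h *; rewrite ler0_norm// -oppr_ge0.
have := @sin_ge_half (`|y| / 2).
rewrite divr_ge0//= ler_pM2r ?invr_gt0// yp => /(_ isT) h; lra.
Qed.

(** The singularity left in a circular Cauchy kernel by a numerator of
   Hoelder exponent 1/2. *)
Definition weak_kernel (y : R) : R := (Num.sqrt `|sin (y / 2)|)^-1.

Lemma weak_kernel_ge0 y : 0 <= weak_kernel y.
Proof. by rewrite invr_ge0 sqrtr_ge0. Qed.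

Lemma measurable_weak_kernel : measurable_fun setT weak_kernel.
Proof.
apply: measurable_funV.
apply: measurableT_comp; first exact: (continuous_measurable_fun (@sqrt_continuous R)).
apply: measurableT_comp => //; apply: meas_sin.
by apply: measurable_funM => //; exact: measurable_id.
Qed.

Lemma weak_kernel_period y : weak_kernel (y + 2 * pi) = weak_kernel y.
Proof. by rewrite /weak_kernel sin_half_period normrN. Qed.

(** The interval is exhausted by the segments [1 / (n + 1), pi], on which
   2 sqrt y is a primitive and the integrals stay below 2 sqrt pi. *)
Lemma integral_inv_sqrt_lty :
  (\int[lam]_(y in `]0%R, pi]%classic) ((Num.sqrt y)^-1)%:E < +oo)%E.
Proof.
have pi2 := @pi_ge2 R.
pose F (n : nat) : set R := `[n.+1%:R^-1, pi]%classic.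
have a0 (n : nat) : 0 < n.+1%:R^-1 :> R by rewrite invr_gt0.
have a1 (n : nat) : n.+1%:R^-1 <= 1 :> R by rewrite invf_le1 ?ler1n.
have mi D : measurable_fun D (fun y : R => ((Num.sqrt y)^-1)%:E).
  apply/measurable_EFinP/measurable_funV/measurable_funTS.
  exact: (continuous_measurable_fun (@sqrt_continuous R)).
have ndF : {homo F : n m / (n <= m)%N >-> (n <= m)%O}.
  move=> n m nm; rewrite subsetEset => t; rewrite /F/= !in_itv/= => /andP[h ->].
  by rewrite andbT (le_trans _ h)// lef_pV2 ?posrE// ler_nat.
have mF i : measurable (F i) by exact: measurable_itv.
have UF : \bigcup_i F i = `]0%R, pi]%classic.
  apply/seteqP; split=> t.
    by move=> [n _]; rewrite /F/= !in_itv/= => /andP[h ->]; rewrite (lt_le_trans (a0 n) h).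
  rewrite /= in_itv/= => /andP[t0 tp]; exists (Num.truncn t^-1) => //.
  rewrite /F/= in_itv/= tp andbT invf_ple ?posrE//.
  by rewrite ltW// truncnS_gt.
have d2 (y : R) : 0 < y -> is_derive y 1 (fun y => 2 * Num.sqrt y) (Num.sqrt y)^-1.
  move=> y0; have h := is_derive1_sqrt y0.
  apply: (is_derive_eq (is_deriveZ 2 h)).
  by rewrite /GRing.scale/=; field; rewrite gt_eqF// sqrtr_gt0.
have IF n : (\int[lam]_(y in F n) ((Num.sqrt y)^-1)%:E <= (2 * Num.sqrt pi)%:E)%E.
  rewrite /F (@continuous_FTC2 _ _ (fun y => 2 * Num.sqrt y)).
  - rewrite -EFinB lee_fin lerBlDr lerDl; by rewrite mulr_ge0// sqrtr_ge0.
  - by apply: (le_lt_trans (a1 n)); lra.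
  - apply/continuous_in_subspaceT => y /set_mem/=; rewrite in_itv/= => /andP[h _].
    apply: cvgV; last exact: sqrt_continuous.
    by rewrite gt_eqF// sqrtr_gt0 (lt_le_trans (a0 n) h).
  - split.
    + move=> y; rewrite in_itv/= => /andP[h _].
      have y0 : 0 < y by rewrite (lt_trans (a0 n) h).
      by case: (d2 _ y0).
    + by apply: cvg_at_right_filter; apply: cvgM; [exact: cvg_cst|exact: sqrt_continuous].
    + by apply: cvg_at_left_filter; apply: cvgM; [exact: cvg_cst|exact: sqrt_continuous].
  - move=> y; rewrite in_itv/= => /andP[h _].
    have y0 : 0 < y by rewrite (lt_trans (a0 n) h).
    by rewrite derive1E; case: (d2 _ y0).
have f0 (i : nat) (y : R) : F i y -> (0 <= ((Num.sqrt y)^-1)%:E)%E.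
  by rewrite lee_fin invr_ge0 sqrtr_ge0.
have cI := @ge0_nondecreasing_set_cvg_integral _ (measurableTypeR R) R F
  (fun y : R => ((Num.sqrt y)^-1)%:E) lam ndF mF (fun i => mi (F i)) f0.
rewrite -UF -(cvg_lim _ cI)//.
apply: (@le_lt_trans _ _ (2 * Num.sqrt pi)%:E); last exact: ltry.
apply: lime_le; first by apply/cvg_ex; eexists; exact: cI.
by near=> n; exact: IF.
Unshelve. all: by end_near. Qed.

Lemma itg_weak_kernel : lam.-integrable C (EFin \o weak_kernel).
Proof.
have mC := @measurable_circle R; have pi0 := @pi_gt0 R.
have mk : measurable_fun setT (fun y : R => (Num.sqrt `|y|)^-1).
  apply: measurable_funV; apply: measurableT_comp => //.
  exact: (continuous_measurable_fun (@sqrt_continuous R)).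
have mke : measurable_fun setT (fun y : R => ((Num.sqrt `|y|)^-1)%:E).
  exact/measurable_EFinP.
have k0 (y : R) : (0 <= ((Num.sqrt `|y|)^-1)%:E)%E.
  by rewrite lee_fin invr_ge0 sqrtr_ge0.
suff ik : lam.-integrable C (EFin \o (fun y => (Num.sqrt `|y|)^-1)).
  apply: (@itg_le _ _ _ _ _ mC _ (fun y => 2 * (Num.sqrt `|y|)^-1)); last exact: itgZ.
    exact: measurable_funTS measurable_weak_kernel.
  move=> y; rewrite /circle/= in_itv/= => /andP[y1 y2].
  rewrite ger0_norm ?weak_kernel_ge0// /weak_kernel.
  have [->|y0] := eqVneq y 0; first by rewrite mul0r sin0 normr0 sqrtr0 invr0 mulr0.
  have yp : `|y| <= pi by rewrite ler_norml; apply/andP; split; lra.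
  have h := norm_le_sin_half yp.
  have y0' : 0 < `|y| by rewrite normr_gt0.
  have s0 : 0 < `|sin (y / 2)| by lra.
  rewrite -[leLHS]invrK -[leRHS]invrK lef_pV2 ?posrE ?invr_gt0 ?mulr_gt0 ?invr_gt0
    ?sqrtr_gt0// invfM !invrK.
  have s2 : Num.sqrt 4 = 2 :> R.
    by rewrite (_ : 4 = 2 ^+ 2) ?sqrtr_sqr ?ger0_norm//; ring.
  rewrite ler_pdivrMl// -[X in X * _]s2 -sqrtrM// ler_wsqrtr//.
apply/integrableP; split; first exact: measurable_funTS mke.
have Cs : C = `](- pi)%R, 0%R]%classic `|` `]0%R, pi]%classic.
  rewrite /circle; apply/seteqP; split=> t /=; rewrite !in_itv/=.
    by move=> /andP[? ?]; have [?|?] := leP t 0; [left|right]; apply/andP; split; lra.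
  by move=> [|] /andP[? ?]; apply/andP; split; lra.
under eq_integral do rewrite /= ger0_norm ?invr_ge0 ?sqrtr_ge0//.
rewrite Cs ge0_integral_setU//=; last 2 first.
- exact: measurable_funTS mke.
- apply/disj_setPS => t /=; rewrite !in_itv/= => -[/andP[? ?] /andP[? ?]]; lra.
have I2 : (\int[lam]_(y in `]0%R, pi]%classic) ((Num.sqrt `|y|)^-1)%:E < +oo)%E.
  have -> : (\int[lam]_(y in `]0%R, pi]%classic) ((Num.sqrt `|y|)^-1)%:E =
             \int[lam]_(y in `]0%R, pi]%classic) ((Num.sqrt y)^-1)%:E)%E.
    apply: eq_integral => y; rewrite inE/= in_itv/= => /andP[y0 _].
    by rewrite gtr0_norm.
  exact: integral_inv_sqrt_lty.
apply: lte_add_pinfty => //; apply: le_lt_trans I2.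
rewrite -(@ge0_integral_reflection _ 0 `](- pi), 0]%classic)//.
rewrite (_ : [set t | `](- pi), 0]%classic (0 - t)] = `[0%R, pi[%classic); last first.
  by apply/seteqP; split=> t /=; rewrite !in_itv/= => /andP[? ?]; apply/andP; split; lra.
under eq_integral do rewrite sub0r normrN.
rewrite -integral_itv_obnd_cbnd; last exact: measurable_funTS mke.
apply: ge0_subset_integral => //.
- exact: measurable_funTS mke.
- by move=> t /=; rewrite !in_itv/= => /andP[? ?]; apply/andP; split; lra.
Qed.

Lemma itg_weak_kernel_shift x : x \in `]- pi, pi] ->
  lam.-integrable C (EFin \o (fun t => weak_kernel (x - t))) /\
  \int[lam]_(t in C) weak_kernel (x - t) = \int[lam]_(t in C) weak_kernel t.
Proof.
move=> xC; split; last first.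
  by apply: Rint_periodic => //; [exact: measurable_weak_kernel|exact: weak_kernel_period].
have me : measurable_fun setT (EFin \o weak_kernel).
  by apply/measurable_EFinP; exact: measurable_weak_kernel.
apply/integrableP; split.
  apply/measurable_EFinP/measurable_funTS; apply: measurableT_comp.
    exact: measurable_weak_kernel.
  by apply: measurable_funB => //; exact: measurable_id.
under eq_integral do rewrite /= ger0_norm ?weak_kernel_ge0//.
rewrite (@ge0_integral_periodic _ x (EFin \o weak_kernel))//.
- have /integrableP[_] := itg_weak_kernel.
  by under eq_integral do rewrite /= ger0_norm ?weak_kernel_ge0//.
- by move=> y; rewrite lee_fin weak_kernel_ge0.
- by move=> y /=; rewrite weak_kernel_period.
Qed.

End kernel.


(** * Absolutely continuous functions with square integrable derivative *)

Section primitives.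
Context {R : realType}.
Local Notation lam := (@lebesgue_measure R).
Local Notation C := (@circle R).
Local Notation itg f := (lam.-integrable C (EFin \o f)).
Local Notation L2 := (sqint lam C).
Implicit Types (f g u v : R -> R).

Lemma sub_circle (x y : R) : - pi <= x -> y <= pi -> `]x, y] `<=` C.
Proof.
by move=> x0 y0 t; rewrite /circle/= !in_itv/= => /andP[? ?]; apply/andP; split; lra.
Qed.

Lemma meas_itv_oc (x y : R) : measurable (`]x, y]%classic : set (measurableTypeR R)).
Proof. exact: measurable_itv. Qed.

Lemma itv_oc_fin (x y : R) : (lam `]x, y] < +oo)%E.
Proof. by rewrite lebesgue_measure_itv/=; case: ifP => _; rewrite -?EFinB ltry. Qed.

Lemma Rint_itv_cst (x y c : R) : x <= y -> \int[lam]_(t in `]x, y]) c = c * (y - x).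
Proof.
move=> xy; rewrite Rintegral_cst; last exact: meas_itv_oc.
have lxy : lam `]x, y] = (y - x)%:E.
  rewrite lebesgue_measure_itv/= lte_fin; case: ltP => [_|yx]; first by rewrite -EFinB.
  by rewrite (_ : y = x) ?subrr//; lra.
by rewrite [fine _]/= lxy.
Qed.

Lemma itg_sub f (x y : R) : itg f -> - pi <= x -> y <= pi ->
  lam.-integrable `]x, y] (EFin \o f).
Proof.
move=> fi x0 y0.
exact: (integrableS (@measurable_circle R) (@meas_itv_oc x y) (sub_circle x0 y0) fi).
Qed.

Lemma sqint_sub f (x y : R) : L2 f -> - pi <= x -> y <= pi -> sqint lam `]x, y] f.
Proof.
move=> [mf f2] x0 y0; split; last exact: itg_sub.
by apply: measurable_funS mf; [exact: measurable_circle|exact: sub_circle].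
Qed.

Lemma Rint_chasles f (x y z : R) : itg f -> - pi <= x -> x <= y -> y <= z ->
  z <= pi ->
  \int[lam]_(t in `]x, z]) f t = \int[lam]_(t in `]x, y]) f t + \int[lam]_(t in `]y, z]) f t.
Proof.
move=> fi x0 xy yz z0.
rewrite -(@Rintegral_itvB _ f (BRight x) (BRight z) y)//; first by rewrite addrC subrK.
exact: itg_sub.
Qed.

(** Absolute continuity, expressed by the integral identity on the closed
   fundamental domain: both ends are included so that periodicity of u can be
   stated as the equality of its end values. *)
Definition primitive u v := L2 v /\
  forall x y : R, - pi <= x -> x <= y -> y <= pi ->
    u y - u x = \int[lam]_(t in `]x, y]) v t.

Lemma primitive_exists v (c : R) : L2 v ->
  primitive (fun x => c + \int[lam]_(t in `]- pi, x]) v t) v.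
Proof.
move=> v2; split=> // x y x0 xy y0.
have vi := sqint_itg (@measurable_circle R) (@circle_fin R) v2.
by rewrite (Rint_chasles vi (lexx _) x0 xy y0); ring.
Qed.

Lemma primitiveD u1 v1 u2 v2 : primitive u1 v1 -> primitive u2 v2 ->
  primitive (fun x => u1 x + u2 x) (fun x => v1 x + v2 x).
Proof.
have mC := @measurable_circle R; have fC := @circle_fin R.
move=> [s1 p1] [s2 p2]; split; first exact: sqintD.
move=> x y x0 xy y0; rewrite RintegralD; last 3 first.
- exact: meas_itv_oc.
- by apply: itg_sub => //; exact: sqint_itg.
- by apply: itg_sub => //; exact: sqint_itg.
by rewrite -p1// -p2//; ring.
Qed.

Lemma primitiveZ (c : R) u v : primitive u v ->
  primitive (fun x => c * u x) (fun x => c * v x).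
Proof.
have mC := @measurable_circle R; have fC := @circle_fin R.
move=> [s1 p1]; split; first exact: sqintZ.
move=> x y x0 xy y0; rewrite RintegralZl; last 2 first.
- exact: meas_itv_oc.
- by apply: itg_sub => //; exact: sqint_itg.
by rewrite -p1//; ring.
Qed.

Lemma primitive_cst (c : R) : primitive (fun=> c) (fun=> 0).
Proof.
split; first by apply: sqint_cst; [exact: measurable_circle|exact: circle_fin].
by move=> x y x0 xy y0; rewrite Rint_itv_cst// mul0r subrr.
Qed.

Lemma primitive_id : primitive id (fun=> 1).
Proof.
split; first by apply: sqint_cst; [exact: measurable_circle|exact: circle_fin].
by move=> x y x0 xy y0; rewrite Rint_itv_cst// mul1r.
Qed.

(** Cauchy-Schwarz on ]x, y]. Keeping the local energy of v, rather than
   its energy on the torus, is what makes these bounds additive in [primitive_comp]. *)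
Lemma primitive_local_holder u v (x y : R) : primitive u v -> - pi <= x -> x <= y ->
  y <= pi -> (u y - u x) ^+ 2 <= (y - x) * \int[lam]_(t in `]x, y]) (v t ^+ 2).
Proof.
move=> [v2 p] x0 xy y0; rewrite p//.
have mI := @meas_itv_oc x y; have fI := itv_oc_fin x y.
have := cauchy_schwarz mI (sqint_cst mI fI 1) (sqint_sub v2 x0 y0).
under eq_Rintegral do rewrite mul1r.
by under [X in X * _]eq_Rintegral do rewrite expr1n; rewrite Rint_itv_cst// mul1r.
Qed.

Lemma Rint_sqr_sub_le v (x y x' y' : R) : L2 v -> - pi <= x' -> x' <= x -> x <= y ->
  y <= y' -> y' <= pi ->
  \int[lam]_(t in `]x, y]) (v t ^+ 2) <= \int[lam]_(t in `]x', y']) (v t ^+ 2).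
Proof.
move=> [mv v2] h1 h2 h3 h4 h5.
rewrite (@Rint_chasles _ x' x y')//; last by lra.
rewrite (@Rint_chasles _ x y y')//; last by lra.
by rewrite addrCA lerDl addr_ge0//; exact: Rint_sqr_ge0.
Qed.

Lemma primitive_holder u v (x y : R) : primitive u v -> x \in `[- pi, pi] ->
  y \in `[- pi, pi] -> (u y - u x) ^+ 2 <= `|y - x| * \int[lam]_(t in C) (v t ^+ 2).
Proof.
move=> p; rewrite !in_itv/= => /andP[x0 x1] /andP[y0 y1].
have main (a b : R) : - pi <= a -> a <= b -> b <= pi ->
    (u b - u a) ^+ 2 <= (b - a) * \int[lam]_(t in C) (v t ^+ 2).
  move=> a0 ab b1; apply: (le_trans (primitive_local_holder p a0 ab b1)).
  apply: ler_wpM2l; first by lra.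
  by apply: Rint_sqr_sub_le => //; by case: p.
have [xy|yx] := leP x y; first by rewrite ger0_norm; [exact: main|lra].
by rewrite ltr0_norm ?opprB; [rewrite -sqrrN opprB; apply: main|]; lra.
Qed.

Lemma holder_measurable f (K : R) :
  (forall x y, x \in `[- pi, pi] -> y \in `[- pi, pi] -> (f y - f x) ^+ 2 <= `|y - x| * K) ->
  measurable_fun C f.
Proof.
move=> fK; apply: (@measurable_funS _ _ _ _ `[- pi, pi]%classic).
- exact: measurable_itv.
- by move=> t; rewrite /circle/= !in_itv/= => /andP[/ltW -> ->].
apply: subspace_continuous_measurable_fun; first exact: measurable_itv.
apply/subspace_continuousP => x xI; apply/cvgrPdist_lt => e e0.
have K1 : 0 < `|K| + 1 by have := normr_ge0 K; lra.
rewrite near_withinE; near=> y => yI; rewrite -ltr_sqr ?nnegrE//; last exact: ltW.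
rewrite real_normK ?num_real//; apply: (@le_lt_trans _ _ (`|x - y| * K)).
  exact: fK.
apply: (@le_lt_trans _ _ (`|x - y| * (`|K| + 1))).
  by apply: ler_wpM2l => //; have := ler_norm K; lra.
rewrite -ltr_pdivlMr//; near: y; apply/nbhs_ballP; exists (e ^+ 2 / (`|K| + 1)) => /=.
  by rewrite divr_gt0// exprn_gt0.
by move=> y.
Unshelve. all: by end_near. Qed.

Lemma primitive_measurable u v : primitive u v -> measurable_fun C u.
Proof.
move=> p; apply: (@holder_measurable _ (\int[lam]_(t in C) (v t ^+ 2))) => x y xI yI.
exact: primitive_holder.
Qed.

Lemma primitive_bounded u v : primitive u v ->
  exists B : R, forall x, x \in `[- pi, pi] -> `|u x| <= B.
Proof.
move=> p; set E := \int[lam]_(t in C) (v t ^+ 2).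
have pi0 := @pi_gt0 R.
have E0 : 0 <= E by exact: Rint_sqr_ge0.
exists (`|u (- pi)| + (2 * pi * E + 1)) => x xI.
have h := @primitive_holder _ _ (- pi) x p _ xI.
rewrite -lerBlDl; apply: (le_trans (lerB_dist _ _)).
have {h} : (u x - u (- pi)) ^+ 2 <= 2 * pi * E.
  apply: (le_trans (h _)); first by rewrite in_itv/= lexx; lra.
  apply: ler_wpM2r => //; move: xI; rewrite in_itv/= => /andP[? ?].
  by rewrite ger0_norm; lra.
rewrite -[X in X <= _](@real_normK _ (u x - u (- pi))) ?num_real//.
move: (normr_ge0 (u x - u (- pi))); move: `|_| => w w0 hw.
have G0 : 0 <= 2 * pi * E by rewrite !mulr_ge0// ltW.
by move: G0 hw; move: (2 * pi * E) => G G0 hw; have [w1|w1] := leP w 1; nra.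
Qed.

Lemma primitive_sqint u v : primitive u v -> L2 u.
Proof.
move=> p; have [B uB] := primitive_bounded p.
apply: (@sqint_bnd _ _ _ _ _ (@measurable_circle R) (@circle_fin R) B).
  exact: primitive_measurable p.
move=> x; rewrite /circle/= in_itv/= => /andP[? ?]; apply: uB.
by rewrite in_itv/=; apply/andP; split; lra.
Qed.

(** Cutting [x, y] into n equal pieces bounds the increment of D by
   K (y - x) (M y - M x) / n, for every n. *)
Lemma superadditive_increment_eq (D M : R -> R) (K a b : R) : 0 <= K ->
  (forall x y, a <= x -> x <= y -> y <= b ->
     `|D y - D x| <= K * ((y - x) * (M y - M x))) ->
  a <= b -> D b = D a.
Proof.
move=> K0 DM ab.
have H n : `|D b - D a| <= K * (b - a) * (M b - M a) / n.+1%:R.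
  pose h := (b - a) / n.+1%:R.
  have n0 : 0 < n.+1%:R :> R by rewrite ltr0n.
  have h0 : 0 <= h by rewrite divr_ge0// subr_ge0.
  have hn : h * n.+1%:R = b - a by rewrite /h divfK// gt_eqF.
  have P (m : nat) : (m <= n.+1)%N ->
     `|D (a + h * m%:R) - D a| <= K * h * (M (a + h * m%:R) - M a).
    elim: m => [|m IH] mn.
      by rewrite mulr0 addr0 !subrr normr0 mulr0.
    have IH' := IH (ltnW mn).
    have mm : a + h * m.+1%:R = a + h * m%:R + h by rewrite -natr1; ring.
    have mb : a + h * m.+1%:R <= b.
      by rewrite -lerBrDl -hn ler_wpM2l// ler_nat.
    have step := DM (a + h * m%:R) (a + h * m.+1%:R) _ _ mb.
    rewrite -(subrK (D (a + h * m%:R)) (D (a + h * m.+1%:R))) -addrA.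
    apply: (le_trans (ler_normD _ _)); apply: (le_trans (lerD (step _ _) IH')).
    - by rewrite lerDl mulr_ge0.
    - by rewrite mm lerDl.
    - by rewrite mm; lra.
  have hb : a + h * n.+1%:R = b by rewrite hn addrC subrK.
  have := P n.+1 (leqnn _); rewrite hb => /le_trans; apply.
  by rewrite /h le_eqVlt; apply/orP; left; apply/eqP; ring.
apply/eqP; rewrite -subr_eq0 -normr_le0; apply/ler_addgt0Pl => e e0; rewrite addr0.
set A := K * (b - a) * (M b - M a) in H.
pose n := Num.truncn (`|A| / e).
apply: (le_trans (H n)); rewrite ler_pdivrMr// mulrC -ler_pdivrMr//.
apply: (le_trans _ (ltW (truncnS_gt _))).
by rewrite ler_pM2r ?invr_gt0// ler_norm.
Qed.

End primitives.

(** * Chain rule and integration by parts *)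

Section chain_rule.
Context {R : realType}.
Local Notation lam := (@lebesgue_measure R).
Local Notation C := (@circle R).
Local Notation itg f := (lam.-integrable C (EFin \o f)).
Local Notation L2 := (sqint lam C).
Implicit Types (f g u v : R -> R).

(** The mean value theorem, with the localisation used for increments of a
   composition: the intermediate point is at least as close to any w as one of
   the ends. *)
Lemma mean_value_between (F F' : R -> R) (a b : R) :
  (forall x : R, is_derive x 1 F (F' x)) ->
  exists c : R, F b - F a = F' c * (b - a) /\
    forall w K, (a - w) ^+ 2 <= K -> (b - w) ^+ 2 <= K -> (c - w) ^+ 2 <= K.
Proof.
move=> dF; have cF x : {for x, continuous F}.
  by apply/differentiable_continuous/derivable1_diffP; case: (dF x).
have main (p q : R) : p <= q ->
    exists c : R, [/\ p <= c, c <= q & F q - F p = F' c * (q - p)].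
  move=> pq; have cpq : {within `[p, q], continuous F}.
    by apply: continuous_subspaceT => x; exact: cF.
  have [c] := MVT_segment pq (fun x _ => dF x) cpq.
  by rewrite in_itv/= => /andP[h1 h2] h3; exists c.
have [ab|ba] := leP a b.
  have [c [h1 h2 h3]] := main _ _ ab; exists c; split => // w K h4 h5.
  have [cw|wc] := leP c w; first by apply: le_trans h4; nra.
  by apply: le_trans h5; nra.
have [c [h1 h2 h3]] := main _ _ (ltW ba); exists c; split => [|w K h4 h5].
  by rewrite -[LHS]opprB h3; ring.
have [cw|wc] := leP c w; first by apply: le_trans h5; nra.
by apply: le_trans h4; nra.
Qed.

Lemma in_circle_cc (x : R) : C x -> x \in `[- pi, pi].
Proof. by rewrite /circle/= !in_itv/= => /andP[/ltW -> ->]. Qed.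

(** On a short interval ]x, y] the increment of F o u differs from the integral
   of v F'(u) by O((y - x) int_x^y v^2), by the Cauchy-Schwarz inequality:
   such errors add up to nothing, by [superadditive_increment_eq]. *)
Lemma primitive_comp (F F' : R -> R) u v : primitive u v ->
  (forall x : R, is_derive x 1 F (F' x)) ->
  (forall B : R, exists L : R, forall a b, `|a| <= B -> `|b| <= B ->
      `|F' a - F' b| <= L * `|a - b|) ->
  primitive (fun x => F (u x)) (fun x => v x * F' (u x)).
Proof.
move=> p dF lF; have mC := @measurable_circle R; have fC := @circle_fin R.
have [B uB] := primitive_bounded p.
have [L0 lip0] := lF B.
pose L := `|L0|; have L_ge0 : 0 <= L by exact: normr_ge0.
have lip (a b : R) : `|a| <= B -> `|b| <= B -> (F' a - F' b) ^+ 2 <= L ^+ 2 * (a - b) ^+ 2.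
  move=> ha hb; have h := lip0 a b ha hb.
  rewrite -exprMn -[leLHS]real_normK ?num_real// -[leRHS]real_normK ?num_real//.
  rewrite lerXn2r ?nnegrE// normrM (ger0_norm L_ge0) (le_trans h)//.
  by rewrite ler_wpM2r// ler_norm.
have mF : measurable_fun C (fun x => F' (u x)).
  apply: (@holder_measurable _ _ (L ^+ 2 * \int[lam]_(t in C) (v t ^+ 2))) => x y xI yI.
  rewrite mulrCA; apply: (le_trans (lip _ _ (uB _ yI) (uB _ xI))).
  by rewrite ler_wpM2l ?sqr_ge0//; exact: primitive_holder.
have [M FM] : exists M : R, forall x, C x -> `|F' (u x)| <= M.
  exists (`|F' (u pi)| + L * (B + B)) => x xC; have xI := in_circle_cc xC.
  have pI : (pi : R) \in `[- pi, pi] by rewrite in_itv/= lexx andbT; have := @pi_gt0 R; lra.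
  rewrite -lerBlDl; apply: (le_trans (lerB_dist _ _)).
  apply: (le_trans (lip0 _ _ (uB _ xI) (uB _ pI))).
  apply: (@le_trans _ _ (L * `|u x - u pi|)); first by rewrite ler_wpM2r// ler_norm.
  apply: ler_wpM2l => //; apply: (le_trans (ler_normB _ _)).
  by rewrite lerD// uB.
have v2 : L2 v by case: p.
have w2 : L2 (fun x => v x * F' (u x)) by exact: (sqintMb mC v2 mF FM).
split=> // x0 y0 hx hxy hy.
pose W x := \int[lam]_(t in `]- pi, x]) (v t * F' (u t)).
have W' x y : - pi <= x -> x <= y -> y <= pi ->
    W y - W x = \int[lam]_(t in `]x, y]) (v t * F' (u t)).
  move=> h1 h2 h3; have [_] := primitive_exists 0 w2 => /(_ x y h1 h2 h3) <-.
  by rewrite !add0r.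
rewrite -W'//; suff : F (u y0) - W y0 = F (u x0) - W x0 by move=> h; lra.
pose M' x := \int[lam]_(t in `]- pi, x]) (v t ^+ 2).
apply: (@superadditive_increment_eq _ (fun x => F (u x) - W x) M' L x0 y0) => //.
move=> x y xx xy yy.
have x1 : - pi <= x by exact: le_trans xx.
have y1 : y <= pi by exact: le_trans hy.
have -> : M' y - M' x = \int[lam]_(t in `]x, y]) (v t ^+ 2).
  rewrite /M' (Rint_chasles _ _ x1 xy y1)//; first by rewrite addrC addKr.
  by case: v2.
set E := \int[lam]_(t in `]x, y]) (v t ^+ 2).
have E0 : 0 <= E by exact: Rint_sqr_ge0.
have [c [Fc cB]] := mean_value_between (u x) (u y) dF.
have mI := @meas_itv_oc R x y; have fI := @itv_oc_fin R x y.
have xI : x \in `[- pi, pi] by rewrite in_itv/= x1 (le_trans xy).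
have yI : y \in `[- pi, pi] by rewrite in_itv/= y1 (le_trans x1).
have cle : `|c| <= B.
  have B0 : 0 <= B by apply: le_trans (uB _ xI).
  have sB (t : R) : `|t| <= B -> (t - 0) ^+ 2 <= B ^+ 2.
    by move=> tB; rewrite subr0 -[leLHS]real_normK ?num_real// lerXn2r ?nnegrE.
  have := cB 0 (B ^+ 2) (sB _ (uB _ xI)) (sB _ (uB _ yI)).
  by rewrite subr0 -[leLHS]real_normK ?num_real// ler_sqr ?nnegrE.
have vI := sqint_sub v2 x1 y1; have wI := sqint_sub w2 x1 y1.
have dI : sqint lam `]x, y] (fun t => F' c - F' (u t)).
  apply: sqintB => //; first exact: sqint_cst.
  apply: (@sqint_bnd _ _ _ _ _ _ _ M) => //.
    by apply: measurable_funS mF => //; exact: sub_circle.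
  by move=> t tI; apply: FM; exact: (sub_circle x1 y1).
have -> : F (u y) - W y - (F (u x) - W x) =
    \int[lam]_(t in `]x, y]) (v t * (F' c - F' (u t))).
  rewrite [LHS](_ : _ = F (u y) - F (u x) - (W y - W x)); last by ring.
  rewrite Fc W'// (proj2 p _ _ x1 xy y1) -RintegralZl//; last exact: sqint_itg.
  rewrite -RintegralB//; [|apply: itgZ => //; exact: sqint_itg|exact: sqint_itg].
  by apply: eq_Rintegral => t _; ring.
rewrite -ler_sqr ?nnegrE//; last by rewrite !mulr_ge0// subr_ge0.
rewrite real_normK ?num_real//.
apply: (le_trans (cauchy_schwarz mI vI dI)); rewrite -/E.
have -> : (L * ((y - x) * E)) ^+ 2 = E * (L ^+ 2 * ((y - x) * E) * (y - x)) by ring.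
apply: ler_wpM2l => //.
rewrite -Rint_itv_cst//; apply: le_Rintegral => //.
- by case: dI.
- by apply: itg_cst.
move=> t; rewrite /= in_itv/= => /andP[t1 t2].
have tI : t \in `[- pi, pi] by rewrite in_itv/=; apply/andP; split; lra.
apply: (le_trans (lip _ _ cle (uB _ tI))); apply: ler_wpM2l; first exact: sqr_ge0.
have sub (a b : R) : x <= a -> a <= b -> b <= y -> (u b - u a) ^+ 2 <= (y - x) * E.
  move=> ha hab hb.
  apply: (le_trans (primitive_local_holder p _ hab _)); [lra|lra|].
  apply: ler_pM; [lra|exact: Rint_sqr_ge0|lra|].
  by apply: Rint_sqr_sub_le => //; lra.
apply: cB; last by apply: sub => //; exact: ltW.
by rewrite -sqrrN opprB; apply: sub => //; exact: ltW.
Qed.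

Lemma primitive_sqr u v : primitive u v ->
  primitive (fun x => u x ^+ 2) (fun x => v x * (2 * u x)).
Proof.
move=> p; apply: (@primitive_comp (fun x => x ^+ 2) (fun x => 2 * x)) => //.
- move=> x; apply: is_derive_eq; rewrite /GRing.scale/=; ring.
- by move=> B; exists 2 => a b _ _; rewrite -mulrBr normrM ger0_norm.
Qed.

Lemma primitive_expR u v : primitive u v ->
  primitive (fun x => expR (u x)) (fun x => v x * expR (u x)).
Proof.
move=> p; apply: (@primitive_comp expR expR) => // B.
exists (expR B) => a b aB bB.
have [c [-> cB]] := @mean_value_between expR expR b a (@is_derive_expR R).
rewrite normrM ler_wpM2r// ger0_norm ?expR_ge0// ler_expR.
have B0 : 0 <= B by exact: le_trans aB.
have sB (t : R) : `|t| <= B -> (t - 0) ^+ 2 <= B ^+ 2.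
  by move=> tB; rewrite subr0 -[leLHS]real_normK ?num_real// lerXn2r ?nnegrE.
have := cB 0 (B ^+ 2) (sB _ bB) (sB _ aB).
rewrite subr0 -[leLHS]real_normK ?num_real// ler_sqr ?nnegrE//.
by move=> ?; rewrite (le_trans (ler_norm c)).
Qed.

(** The product rule is the chain rule for squares, by polarisation. *)
Lemma primitiveM f f' g g' : primitive f f' -> primitive g g' ->
  primitive (fun x => f x * g x) (fun x => f' x * g x + f x * g' x).
Proof.
move=> pf pg.
have h := primitiveD (primitiveZ 4^-1 (primitive_sqr (primitiveD pf pg)))
  (primitiveZ (- 4^-1) (primitive_sqr (primitiveD pf (primitiveZ (-1) pg)))).
have e1 : (fun x => f x * g x) =
    fun x => 4^-1 * (f x + g x) ^+ 2 + - 4^-1 * (f x + -1 * g x) ^+ 2.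
  by apply/funext => x; field.
have e2 : (fun x => f' x * g x + f x * g' x) =
    fun x => 4^-1 * ((f' x + g' x) * (2 * (f x + g x))) +
       - 4^-1 * ((f' x + -1 * g' x) * (2 * (f x + -1 * g x))).
  by apply/funext => x; field.
by rewrite e1 e2.
Qed.

Definition equal_ends u := u pi = u (- pi).

Lemma Rint_primitive u v : primitive u v -> equal_ends u -> \int[lam]_(x in C) v x = 0.
Proof.
move=> [_ /(_ (- pi) pi (lexx _) _ (lexx _))] h cu.
by rewrite /circle -h; [rewrite cu subrr|have := @pi_gt0 R; lra].
Qed.

Lemma by_parts f f' g g' : primitive f f' -> primitive g g' -> equal_ends f -> equal_ends g ->
  \int[lam]_(x in C) (f' x * g x) = - \int[lam]_(x in C) (f x * g' x).
Proof.
move=> pf pg cf cg; have mC := @measurable_circle R; have fC := @circle_fin R.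
have := Rint_primitive (primitiveM pf pg).
rewrite RintegralD//.
- by move=> h; apply/eqP; rewrite -subr_eq0 opprK h// /equal_ends cf cg.
- by apply: sqint_itgM => //; [by case: pf|exact: primitive_sqint pg].
- by apply: sqint_itgM => //; [exact: primitive_sqint pf|by case: pg].
Qed.

Lemma primitive_cos (k : nat) :
  primitive (fun x : R => cos (k%:R * x)) (fun x => k%:R * - sin (k%:R * x)).
Proof.
have := primitive_comp (primitiveZ k%:R (@primitive_id R)) (@is_derive_cos R).
rewrite mulr1; apply => B; exists 1 => a b _ _; rewrite mul1r.
have [c [h _]] := @mean_value_between sin cos b a (@is_derive_sin R).
have -> : `|- sin a - - sin b| = `|sin a - sin b|.
  by rewrite -normrN; congr (`|_|); ring.
rewrite h normrM ler_piMl//.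
by rewrite ler_norml cos_geN1 cos_le1.
Qed.

Lemma primitive_sin (k : nat) :
  primitive (fun x : R => sin (k%:R * x)) (fun x => k%:R * cos (k%:R * x)).
Proof.
have := primitive_comp (primitiveZ k%:R (@primitive_id R)) (@is_derive_sin R).
rewrite mulr1; apply => B; exists 1 => a b _ _; rewrite mul1r.
have [c [h _]] := @mean_value_between cos (fun x => - sin x) b a (@is_derive_cos R).
by rewrite h normrM ler_piMl// normrN sin_max.
Qed.

Lemma equal_ends_cos (k : nat) : equal_ends (fun x : R => cos (k%:R * x)).
Proof. by rewrite /equal_ends mulrN cosN. Qed.

Lemma equal_ends_sin (k : nat) : equal_ends (fun x : R => sin (k%:R * x)).
Proof. by rewrite /equal_ends -(sin_period k (- pi)); congr (sin (_ * _)); ring. Qed.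

End chain_rule.

(** * Fourier coefficients and the Bessel inequality *)

Section fourier.
Context {R : realType}.
Local Notation lam := (@lebesgue_measure R).
Local Notation C := (@circle R).
Local Notation itg f := (lam.-integrable C (EFin \o f)).
Local Notation L2 := (sqint lam C).
Local Notation I f := (\int[lam]_(x in C) f x).
Implicit Types (f g u v : R -> R) (a b : nat -> R).

Let mC := @measurable_circle R.
Let fC := @circle_fin R.

Definition ccoef f (k : nat) := \int[lam]_(x in C) (f x * cos (k%:R * x)).
Definition scoef f (k : nat) := \int[lam]_(x in C) (f x * sin (k%:R * x)).

Lemma meas_cosk (D : set R) (k : nat) : measurable_fun D (fun x : R => cos (k%:R * x)).
Proof. by apply: meas_cos; apply: measurable_funM => //; exact: measurable_id. Qed.

Lemma meas_sink (D : set R) (k : nat) : measurable_fun D (fun x : R => sin (k%:R * x)).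
Proof. by apply: meas_sin; apply: measurable_funM => //; exact: measurable_id. Qed.

Lemma sqint_cosk (k : nat) : L2 (fun x => cos (k%:R * x)).
Proof.
apply: (sqint_bnd mC fC (M := 1)); first exact: meas_cosk.
by move=> x _; exact: cos_max.
Qed.

Lemma sqint_sink (k : nat) : L2 (fun x => sin (k%:R * x)).
Proof.
apply: (sqint_bnd mC fC (M := 1)); first exact: meas_sink.
by move=> x _; exact: sin_max.
Qed.

Lemma itgM_bnd (M : R) f g : itg f -> measurable_fun C g ->
  (forall x, C x -> `|g x| <= M) -> itg (fun x => f x * g x).
Proof.
move=> fi mg gM; apply: (@itg_le _ _ _ _ _ mC _ (fun x => M * `|f x|)).
- by apply: measurable_funM => //; exact: itg_meas fi.
- by move=> x xC; rewrite normrM mulrC ler_wpM2r// gM.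
- by apply: itgZ => //; exact: itg_abs.
Qed.

Lemma itgM_cosk f (k : nat) : itg f -> itg (fun x => f x * cos (k%:R * x)).
Proof.
move=> fi; apply: (@itgM_bnd 1) => //; first exact: meas_cosk.
by move=> x _; exact: cos_max.
Qed.

Lemma itgM_sink f (k : nat) : itg f -> itg (fun x => f x * sin (k%:R * x)).
Proof.
move=> fi; apply: (@itgM_bnd 1) => //; first exact: meas_sink.
by move=> x _; exact: sin_max.
Qed.

Lemma ccoef0 f : ccoef f 0 = I f.
Proof. by apply: eq_Rintegral => x _; rewrite mul0r cos0 mulr1. Qed.

Lemma scoef0 f : scoef f 0 = 0.
Proof.
rewrite /scoef; under eq_Rintegral do rewrite mul0r sin0 mulr0.
by rewrite Rint_circle_cst mul0r.
Qed.

Lemma ccoefD f g k : itg f -> itg g -> ccoef (fun x => f x + g x) k = ccoef f k + ccoef g k.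
Proof.
move=> fi gi; rewrite /ccoef -RintegralD//; [|exact: itgM_cosk|exact: itgM_cosk].
by apply: eq_Rintegral => x _; rewrite mulrDl.
Qed.

Lemma scoefD f g k : itg f -> itg g -> scoef (fun x => f x + g x) k = scoef f k + scoef g k.
Proof.
move=> fi gi; rewrite /scoef -RintegralD//; [|exact: itgM_sink|exact: itgM_sink].
by apply: eq_Rintegral => x _; rewrite mulrDl.
Qed.

Lemma ccoefZ (c : R) f k : itg f -> ccoef (fun x => c * f x) k = c * ccoef f k.
Proof.
move=> fi; rewrite /ccoef -RintegralZl//; last exact: itgM_cosk.
by apply: eq_Rintegral => x _; rewrite mulrA.
Qed.

Lemma scoefZ (c : R) f k : itg f -> scoef (fun x => c * f x) k = c * scoef f k.
Proof.
move=> fi; rewrite /scoef -RintegralZl//; last exact: itgM_sink.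
by apply: eq_Rintegral => x _; rewrite mulrA.
Qed.

Lemma ccoefB f g k : itg f -> itg g -> ccoef (fun x => f x - g x) k = ccoef f k - ccoef g k.
Proof.
move=> fi gi; rewrite ccoefD//; last exact: itgN.
congr (_ + _); rewrite -mulN1r -ccoefZ//.
by apply: eq_Rintegral => x _; rewrite mulN1r.
Qed.

Lemma scoefB f g k : itg f -> itg g -> scoef (fun x => f x - g x) k = scoef f k - scoef g k.
Proof.
move=> fi gi; rewrite scoefD//; last exact: itgN.
congr (_ + _); rewrite -mulN1r -scoefZ//.
by apply: eq_Rintegral => x _; rewrite mulN1r.
Qed.

Lemma ccoef_primitive u v (k : nat) : primitive u v -> equal_ends u ->
  ccoef v k = k%:R * scoef u k.
Proof.
move=> p cu; rewrite /ccoef (by_parts p (primitive_cos k) cu (@equal_ends_cos _ _)).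
rewrite /scoef -RintegralZl//; last first.
  by apply: sqint_itgM => //; [exact: primitive_sqint p|exact: sqint_sink].
rewrite -mulN1r -RintegralZl//; last first.
  by apply: sqint_itgM => //; [exact: primitive_sqint p|case: (primitive_cos (R := R) k)].
by apply: eq_Rintegral => x _; ring.
Qed.

Lemma scoef_primitive u v (k : nat) : primitive u v -> equal_ends u ->
  scoef v k = - (k%:R * ccoef u k).
Proof.
move=> p cu; rewrite /scoef (by_parts p (primitive_sin k) cu (@equal_ends_sin _ _)).
congr (- _); rewrite /ccoef -RintegralZl//; last first.
  by apply: sqint_itgM => //; [exact: primitive_sqint p|exact: sqint_cosk].
by apply: eq_Rintegral => x _; ring.
Qed.

Lemma scoef_cos (j k : nat) : scoef (fun x => cos (j%:R * x)) k = 0.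
Proof.
apply: (@Rint_odd R (fun x => cos (j%:R * x) * sin (k%:R * x))).
- by apply: measurable_funM; [exact: meas_cosk|exact: meas_sink].
- by move=> y; rewrite cos_period sin_period.
- by move=> y; rewrite !mulrN cosN sinN mulrN.
Qed.

Lemma ccoef_sin (j k : nat) : ccoef (fun x => sin (j%:R * x)) k = 0.
Proof.
rewrite -(scoef_cos k j); apply: eq_Rintegral => x _; exact: mulrC.
Qed.

(** Differentiating one factor or the other gives j CC = k SS and j SS = k CC
   for the two integrals CC and SS; hence both vanish when j <> k, and they
   share \int 1 when j = k. *)
Lemma cos_sin_orthogonal (j k : nat) : (0 < k)%N ->
  ccoef (fun x => cos (j%:R * x)) k = pi *+ (j == k) /\
  scoef (fun x => sin (j%:R * x)) k = pi *+ (j == k).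
Proof.
move=> k0.
set CC := ccoef _ _; set SS := scoef _ _.
have e1 : j%:R * CC = k%:R * SS.
  rewrite -(ccoef_primitive k (primitive_sin j) (@equal_ends_sin _ j)) -ccoefZ//.
  by apply: sqint_itg => //; exact: sqint_cosk.
have e2 : j%:R * SS = k%:R * CC.
  apply: oppr_inj.
  rewrite -(scoef_primitive k (primitive_cos j) (@equal_ends_cos _ j)).
  rewrite -mulNr -scoefZ; last by apply: sqint_itg => //; exact: sqint_sink.
  by apply: eq_Rintegral => x _; ring.
have kr0 : k%:R != 0 :> R by rewrite pnatr_eq0 -lt0n.
have [jk|jk] := eqVneq j k.
  move: e2; rewrite jk mulr1n => /(mulfI kr0) SC.
  suff : CC + SS = 2 * pi by rewrite SC => h; split; lra.
  rewrite /CC /SS /ccoef /scoef jk -RintegralD//.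
  - transitivity (\int[lam]_(x in C) (1 : R)); last by rewrite Rint_circle_cst mul1r.
    by apply: eq_Rintegral => x _; rewrite -!expr2 cos2Dsin2.
  - by apply: sqint_itgM => //; exact: sqint_cosk.
  - by apply: sqint_itgM => //; exact: sqint_sink.
rewrite mulr0n.
have : (j%:R ^+ 2 - k%:R ^+ 2) * CC = 0.
  have : j%:R * (j%:R * CC) = k%:R * (j%:R * SS) by rewrite e1; ring.
  by rewrite e2 => h; ring: h.
move/eqP; rewrite mulf_eq0 subr_eq0 -!natrX eqr_nat eqn_sqr (negbTE jk)/= => /eqP CC0.
split=> //; move: e1; rewrite CC0 mulr0 => /esym/eqP.
by rewrite mulf_eq0 (negbTE kr0) => /eqP.
Qed.

Lemma Rint_cosk (k : nat) : (0 < k)%N -> \int[lam]_(x in C) cos (k%:R * x) = 0.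
Proof.
move=> k0; have := proj1 (cos_sin_orthogonal 0 k0); rewrite (ltn_eqF k0) [X in _ = X -> _]mulr0n => <-.
by apply: eq_Rintegral => x _; rewrite mul0r cos0 mul1r.
Qed.

Lemma Rint_sink (k : nat) : \int[lam]_(x in C) sin (k%:R * x) = 0.
Proof. by rewrite -[RHS](ccoef_sin k 0) ccoef0. Qed.

(** The normalisation makes [a k] and [b k] the integrals against cos k and
   sin k. *)
Definition trig_poly (a b : nat -> R) (n : nat) (x : R) : R :=
  pi^-1 * \sum_(1 <= k < n.+1) (a k * cos (k%:R * x) + b k * sin (k%:R * x)).

Definition fourier_sum f := trig_poly (ccoef f) (scoef f).

Let sqint_term (a b : nat -> R) (k : nat) :
  L2 (fun x => a k * cos (k%:R * x) + b k * sin (k%:R * x)).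
Proof.
by apply: sqintD => //; apply: sqintZ => //; [exact: sqint_cosk|exact: sqint_sink].
Qed.

Lemma sqint_trig_poly a b n : L2 (trig_poly a b n).
Proof. by apply: sqintZ => //; apply: sqint_sum. Qed.

Lemma trig_poly_inner a b n f : L2 f -> \int[lam]_(x in C) (trig_poly a b n x * f x) =
  pi^-1 * \sum_(1 <= k < n.+1) (a k * ccoef f k + b k * scoef f k).
Proof.
move=> f2.
have itk k : itg (fun x => (a k * cos (k%:R * x) + b k * sin (k%:R * x)) * f x).
  exact: sqint_itgM.
transitivity (pi^-1 * \int[lam]_(x in C) \sum_(1 <= k < n.+1)
    ((a k * cos (k%:R * x) + b k * sin (k%:R * x)) * f x)).
  rewrite -RintegralZl//; last exact: itg_sum.
  by apply: eq_Rintegral => x _; rewrite /trig_poly -mulrA mulr_suml.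
congr (_ * _); rewrite Rint_sum//; apply: eq_bigr => k _.
have i1 : itg (fun x => f x * cos (k%:R * x)) by apply: itgM_cosk; exact: sqint_itg.
have i2 : itg (fun x => f x * sin (k%:R * x)) by apply: itgM_sink; exact: sqint_itg.
rewrite /ccoef /scoef -!RintegralZl// -RintegralD//; [|exact: itgZ|exact: itgZ].
by apply: eq_Rintegral => x _; ring.
Qed.

Let pi_neq0 : pi != 0 :> R. Proof. by rewrite gt_eqF// pi_gt0. Qed.

Lemma ccoef_trig_poly a b n k : (0 < k <= n)%N -> ccoef (trig_poly a b n) k = a k.
Proof.
move=> /andP[k0 kn]; rewrite /ccoef trig_poly_inner; last exact: sqint_cosk.
rewrite (bigD1_seq k) ?iota_uniq ?mem_index_iota ?k0//=.
rewrite big1_seq ?addr0; last first.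
  move=> j /andP[jk _].
  rewrite (_ : scoef _ _ = 0) ?mulr0 ?addr0; last exact: scoef_cos.
  rewrite (_ : ccoef _ _ = 0) ?mulr0//.
  have := proj1 (cos_sin_orthogonal j k0); rewrite (negbTE jk) mulr0n => <-.
  by apply: eq_Rintegral => x _; exact: mulrC.
rewrite scoef_cos (proj1 (cos_sin_orthogonal k k0)) eqxx mulr1n mulr0 addr0.
by rewrite mulrCA mulVf ?mulr1.
Qed.

Lemma scoef_trig_poly a b n k : (0 < k <= n)%N -> scoef (trig_poly a b n) k = b k.
Proof.
move=> /andP[k0 kn]; rewrite /scoef trig_poly_inner; last exact: sqint_sink.
rewrite (bigD1_seq k) ?iota_uniq ?mem_index_iota ?k0//=.
rewrite big1_seq ?addr0; last first.
  move=> j /andP[jk _].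
  rewrite (_ : ccoef _ _ = 0) ?mulr0 ?add0r; last exact: ccoef_sin.
  rewrite (_ : scoef _ _ = 0) ?mulr0//.
  have := proj2 (cos_sin_orthogonal j k0); rewrite (negbTE jk) mulr0n => <-.
  by apply: eq_Rintegral => x _; exact: mulrC.
rewrite ccoef_sin (proj2 (cos_sin_orthogonal k k0)) eqxx mulr1n mulr0 add0r.
by rewrite mulrCA mulVf ?mulr1.
Qed.

Lemma trig_poly_sqnorm a b n : \int[lam]_(x in C) (trig_poly a b n x ^+ 2) =
  pi^-1 * \sum_(1 <= k < n.+1) (a k ^+ 2 + b k ^+ 2).
Proof.
under eq_Rintegral do rewrite expr2.
rewrite trig_poly_inner; last exact: sqint_trig_poly.
congr (_ * _); apply: eq_big_nat => k /andP[k0 kn].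
by rewrite ccoef_trig_poly ?scoef_trig_poly ?k0.
Qed.

Lemma bessel f n : L2 f ->
  pi^-1 * \sum_(1 <= k < n.+1) (ccoef f k ^+ 2 + scoef f k ^+ 2) <=
  \int[lam]_(x in C) (f x ^+ 2).
Proof.
move=> f2; set s := leLHS.
have : 0 <= I (fun x => (f x - fourier_sum f n x) ^+ 2) by exact: Rint_sqr_ge0.
have S2 := sqint_trig_poly (ccoef f) (scoef f) n.
have -> : I (fun x => (f x - fourier_sum f n x) ^+ 2) = I (fun x => f x ^+ 2 -
     (2 * (fourier_sum f n x * f x) - fourier_sum f n x ^+ 2)).
  by apply: eq_Rintegral => x _; ring.
have i1 : itg (fun x => fourier_sum f n x * f x) by exact: sqint_itgM.
rewrite !RintegralB//; [|exact: itgZ|by case: S2|by case: f2|].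
  rewrite RintegralZl// trig_poly_inner// trig_poly_sqnorm.
  rewrite (_ : pi^-1 * _ = s) /s; last first.
    by congr (_ * _); apply: eq_bigr => k _; rewrite !expr2.
  by move=> h; rewrite -subr_ge0; move: h; congr (0 <= _); ring.
by apply: itgB => //; [exact: itgZ|case: S2].
Qed.

End fourier.

(** * The Riemann-Lebesgue lemma *)

Section riemann_lebesgue.
Context {R : realType}.
Local Notation lam := (@lebesgue_measure R).
Local Notation C := (@circle R).
Local Notation itg f := (lam.-integrable C (EFin \o f)).
Local Notation L2 := (sqint lam C).
Implicit Types (f g u v : R -> R).

Let mC := @measurable_circle R.
Let fC := @circle_fin R.

(** By the Bessel inequality the squares of the coefficients are summable. *)
Lemma sqint_coef_cvg0 f : L2 f ->
  ccoef f n @[n --> \oo] --> (0 : R) /\ scoef f n @[n --> \oo] --> (0 : R).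
Proof.
move=> f2; set E := \int[lam]_(x in C) (f x ^+ 2).
pose t k := ccoef f k.+1 ^+ 2 + scoef f k.+1 ^+ 2.
have t0 k : 0 <= t k by rewrite addr_ge0// sqr_ge0.
have cs : cvgn (series t).
  apply: nondecreasing_is_cvgn.
    by apply: nondecreasing_series => n _ _.
  exists (pi * E) => _ [n _ <-]; rewrite /series/= /t.
  have := bessel n f2; rewrite ler_pdivrMl ?pi_gt0// big_add1/= => h.
  exact: h.
have t_cvg : t n @[n --> \oo] --> (0 : R) by exact: cvg_series_cvg_0.
have sq (c : nat -> R) : (forall k, c k.+1 ^+ 2 <= t k) -> c n @[n --> \oo] --> (0 : R).
  move=> ct; rewrite -(cvg_shiftS c); apply/cvgr0Pnorm_lt => e e0.
  have e2 : 0 < e ^+ 2 by rewrite exprn_gt0.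
  move/cvgr0Pnorm_lt : t_cvg => /(_ _ e2); apply: filterS => n /= h.
  rewrite -ltr_sqr ?nnegrE//; last exact: ltW.
  rewrite real_normK ?num_real//; apply: (le_lt_trans (ct n)).
  by rewrite (le_lt_trans _ h)// ler_norm.
split; apply: sq => k; rewrite /t.
- by rewrite lerDl sqr_ge0.
- by rewrite lerDr sqr_ge0.
Qed.

(** Truncating f at height M leaves a square integrable function, whose
   coefficients vanish at infinity by Bessel, and an integrable error that is
   small in mean. *)
Lemma riemann_lebesgue f : itg f ->
  ccoef f n @[n --> \oo] --> (0 : R) /\ scoef f n @[n --> \oo] --> (0 : R).
Proof.
move=> fi; have mf := itg_meas fi.
pose B (M : nat) := [set x | `|f x| <= M%:R].
pose g (M : nat) := fun x => if `|f x| <= M%:R then f x else 0.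
have mg M : measurable_fun C (g M).
  apply: (measurable_fun_if mC) => //.
  - by apply: measurable_fun_ler => //; exact: measurableT_comp.
  - by apply: measurable_funS mf.
have gM M x : `|g M x| <= M%:R.
  by rewrite /g; case: ifP => // _; rewrite normr0.
have g2 M : L2 (g M) by apply: (sqint_bnd mC fC (mg M) (M := M%:R)) => x _.
have gi M : itg (g M) by exact: sqint_itg.
have D0 : \int[lam]_(x in C) `|f x - g M x| @[M --> \oo] --> (0 : R).
  have := @Rint_dominated _ _ _ lam C mC (fun M x => `|f x - g M x|) (fun=> 0)
    (fun x => `|f x|).
  rewrite Rint_circle_cst mul0r => h; apply: (proj2 (h _ _ _ _)).
  - move=> M; have mfg : measurable_fun C (fun x => f x - g M x) by exact: measurable_funB.
    exact: measurableT_comp.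
  - move=> x _; apply/cvgrPdist_lt => e e0; near=> M.
    rewrite sub0r normrN normr_id /g ifT ?subrr ?normr0//.
    by apply: ltW; near: M; exact: nbhs_infty_gtr.
  - exact: itg_abs.
  - move=> M x _; rewrite normr_id /g; case: ifP => _; last by rewrite subr0.
    by rewrite subrr normr0.
have main (c : (R -> R) -> nat -> R) :
    (forall h, L2 h -> c h n @[n --> \oo] --> (0 : R)) ->
    (forall M n, `|c f n - c (g M) n| <= \int[lam]_(x in C) `|f x - g M x|) ->
    c f n @[n --> \oo] --> (0 : R).
  move=> c2 cB; apply/cvgr0Pnorm_lt => e e0.
  have e2 : 0 < e / 2 by rewrite divr_gt0.
  move/cvgr0Pnorm_lt : (D0) => /(_ _ e2) [M _ /(_ M (leqnn M))/= DM].
  move/cvgr0Pnorm_lt : (c2 _ (g2 M)) => /(_ _ e2); apply: filterS => n /= h.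
  rewrite -(subrK (c (g M) n) (c f n)); apply: (le_lt_trans (ler_normD _ _)).
  rewrite (splitr e) ltrD//; apply: le_lt_trans DM.
  by apply: (le_trans (cB M n)); exact: ler_norm.
split; apply: main => //.
- by move=> h /sqint_coef_cvg0 [].
- move=> M n; rewrite -ccoefB//.
  have hi : itg (fun x => f x - g M x) by exact: itgB.
  apply: (le_trans (le_normr_Rintegral _ _)) => //; first exact: itgM_cosk.
  apply: le_Rintegral => //.
  + by apply: itg_abs => //; exact: itgM_cosk.
  + exact: itg_abs.
  + by move=> x _; rewrite normrM ler_piMr// cos_max.
- by move=> h /sqint_coef_cvg0 [].
- move=> M n; rewrite -scoefB//.
  have hi : itg (fun x => f x - g M x) by exact: itgB.
  apply: (le_trans (le_normr_Rintegral _ _)) => //; first exact: itgM_sink.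
  apply: le_Rintegral => //.
  + by apply: itg_abs => //; exact: itgM_sink.
  + exact: itg_abs.
  + by move=> x _; rewrite normrM ler_piMr// sin_max.
Unshelve. all: by end_near. Qed.

End riemann_lebesgue.

(** * Pointwise convergence of Fourier series *)

Section pointwise_convergence.
Context {R : realType}.
Local Notation lam := (@lebesgue_measure R).
Local Notation C := (@circle R).
Local Notation itg f := (lam.-integrable C (EFin \o f)).
Local Notation L2 := (sqint lam C).
Implicit Types (f g u v : R -> R).

Let mC := @measurable_circle R.
Let fC := @circle_fin R.

(** Hoelder continuity in the metric of the torus: when the shorter arc from t
   to x passes through the endpoints, the two pieces are joined by [equal_ends]. *)
Lemma primitive_circle_holder u v (x t : R) : primitive u v -> equal_ends u -> C x -> C t ->
  (u t - u x) ^+ 2 <= 8 * \int[lam]_(s in C) (v s ^+ 2) * `|sin ((x - t) / 2)|.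
Proof.
move=> p cu xC tC; set E := \int[lam]_(s in C) (v s ^+ 2).
have E0 : 0 <= E by exact: Rint_sqr_ge0.
have pi0 := @pi_gt0 R.
have lI : - pi \in `[- pi, pi : R] by rewrite in_itv/=; apply/andP; split; lra.
have rI : (pi : R) \in `[- pi, pi : R] by rewrite in_itv/=; apply/andP; split; lra.
wlog tx : x t xC tC / t <= x.
  move=> h; have [tx|xt] := leP t x; first exact: h.
  rewrite -sqrrN opprB -normrN -sinN -mulNr opprB; exact: h (ltW xt).
have xI := in_circle_cc xC; have tI := in_circle_cc tC.
have [d|d] := leP (x - t) pi.
  apply: (le_trans (primitive_holder p xI tI)); rewrite -/E.
  rewrite distrC ger0_norm ?subr_ge0// mulrC -mulrA mulrCA.
  apply: ler_wpM2l => //.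
  have h := @norm_le_sin_half _ (x - t); rewrite ger0_norm ?subr_ge0// in h.
  by have := h d; have := normr_ge0 (sin ((x - t) / 2)); lra.
have h1 := primitive_holder p lI tI; have h2 := primitive_holder p xI rI.
rewrite -/E in h1 h2.
move: xI tI; rewrite !in_itv/= => /andP[x1 x2] /andP[t1 t2].
rewrite ger0_norm in h1; last by lra.
rewrite ger0_norm in h2; last by lra.
have -> : u t - u x = (u t - u (- pi)) + (u pi - u x) by rewrite cu; ring.
have h3 := @norm_le_sin_half _ (2 * pi - (x - t)); rewrite ger0_norm in h3; last by lra.
have e : sin ((2 * pi - (x - t)) / 2) = sin ((x - t) / 2).
  have -> : (2 * pi - (x - t)) / 2 = - ((x - t) / 2) + pi by field.
  by rewrite sinDpi sinN opprK.
rewrite e in h3; have {}h3 := h3 (ltac:(lra)).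
move: h1 h2 h3; move: (u t - u (- pi)) (u pi - u x) `|sin _| => a b s h1 h2 h3.
have ab : (a + b) ^+ 2 <= 2 * (a ^+ 2 + b ^+ 2) by have := sqr_ge0 (a - b); nra.
apply: (le_trans ab).
apply: (@le_trans _ _ (2 * ((t - - pi + (pi - x)) * E))); first by rewrite mulrDl; lra.
rewrite mulrAC -[8 * s * E]mulrA [X in _ <= X]mulrA mulrA ler_wpM2r//; lra.
Qed.

(** The conjugate function of u at x is - 1 / (2 pi) times the integral of this
   quotient, in which the subtraction of u x replaces the principal value. *)
Definition cauchy_diff u (x t : R) : R := (u t - u x) / tan ((x - t) / 2).

(** The numerator is of order |sin ((x - t) / 2)|^(1/2), by
   [primitive_circle_holder], and the denominator of order |sin ((x - t) / 2)|. *)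
Lemma cauchy_diff_le u v (x t : R) : primitive u v -> equal_ends u -> C x -> C t ->
  `|cauchy_diff u x t| <=
  Num.sqrt (8 * \int[lam]_(s in C) (v s ^+ 2)) * weak_kernel (x - t).
Proof.
move=> p cu xC tC; rewrite /cauchy_diff /weak_kernel /tan.
have := primitive_circle_holder p cu xC tC.
set E := \int[lam]_(s in C) (v s ^+ 2).
have E0 : 0 <= 8 * E by rewrite mulr_ge0//; exact: Rint_sqr_ge0.
have [->|s0] := eqVneq (sin ((x - t) / 2)) 0.
  by rewrite mul0r invr0 mulr0 normr0 sqrtr0 invr0 mulr0.
rewrite invf_div !normrM normfV => h.
have s1 : 0 < `|sin ((x - t) / 2)| by rewrite normr_gt0.
have q0 : 0 < Num.sqrt `|sin ((x - t) / 2)| by rewrite sqrtr_gt0.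
have ut : `|u t - u x| <= Num.sqrt (8 * E) * Num.sqrt `|sin ((x - t) / 2)|.
  by rewrite -sqrtrM// -sqrtr_sqr ler_wsqrtr.
have c1 := @cos_max R ((x - t) / 2).
rewrite mulrA ler_pdivrMr//.
apply: (@le_trans _ _ (`|u t - u x|)); first by rewrite ler_piMr.
apply: (le_trans ut); rewrite -mulrA; apply: ler_wpM2l; first exact: sqrtr_ge0.
rewrite -{3}(sqr_sqrtr (ltW s1)).
by rewrite expr2 mulKf// gt_eqF.
Qed.

Lemma meas_tan (D : set R) (x : R) : measurable_fun D (fun t => (tan ((x - t) / 2))^-1).
Proof.
have m : measurable_fun D (fun t : R => (x - t) / 2).
  apply: measurable_funM => //; apply: measurable_funB => //; exact: measurable_id.
apply: measurable_funV; rewrite /tan; apply: measurable_funM; first exact: meas_sin.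
by apply: measurable_funV; exact: meas_cos.
Qed.

Lemma meas_cauchy_diff u (x : R) : measurable_fun C u -> measurable_fun C (cauchy_diff u x).
Proof.
move=> mu; apply: measurable_funM; last exact: meas_tan.
exact: measurable_funB.
Qed.

Lemma itg_cauchy_diff u v (x : R) : primitive u v -> equal_ends u -> C x ->
  itg (cauchy_diff u x).
Proof.
move=> p cu xC.
have [ik _] := itg_weak_kernel_shift xC.
apply: (@itg_le _ _ _ _ _ mC _ (fun t =>
   Num.sqrt (8 * \int[lam]_(s in C) (v s ^+ 2)) * weak_kernel (x - t))).
- by apply: meas_cauchy_diff; exact: primitive_measurable p.
- by move=> t tC; exact: cauchy_diff_le.
- exact: itgZ.
Qed.

(** sin (n y) / tan (y / 2) is a trigonometric polynomial, built by this
   recursion. *)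
Lemma cot_half_diff (n : nat) (y : R) : sin (y / 2) != 0 ->
  (sin (n.+1%:R * y) - sin (n%:R * y)) / tan (y / 2) =
  cos (n.+1%:R * y) + cos (n%:R * y).
Proof.
move=> s0; rewrite /tan invf_div.
have -> : n.+1%:R * y = (n%:R + 2^-1) * y + y / 2 by rewrite -natr1; field.
have -> : n%:R * y = (n%:R + 2^-1) * y - y / 2 by field.
by rewrite sinD sinB cosD cosB; field.
Qed.

Lemma Rint_cos_shift f n (x : R) : itg f ->
  \int[lam]_(t in C) (f t * cos (n%:R * (x - t))) =
  cos (n%:R * x) * ccoef f n + sin (n%:R * x) * scoef f n.
Proof.
move=> fi; have i1 := itgM_cosk n fi; have i2 := itgM_sink n fi.
rewrite /ccoef /scoef -!RintegralZl// -RintegralD//; [|exact: itgZ|exact: itgZ].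
by apply: eq_Rintegral => t _; rewrite mulrBr cosB; ring.
Qed.

Lemma Rint_sin_shift f n (x : R) : itg f ->
  \int[lam]_(t in C) (f t * sin (n%:R * (x - t))) =
  sin (n%:R * x) * ccoef f n - cos (n%:R * x) * scoef f n.
Proof.
move=> fi; have i1 := itgM_cosk n fi; have i2 := itgM_sink n fi.
rewrite /ccoef /scoef -!RintegralZl// -RintegralB//; [|exact: itgZ|exact: itgZ].
by apply: eq_Rintegral => t _; rewrite mulrBr sinB; ring.
Qed.

Lemma itgM_cos_shift f n (x : R) : itg f -> itg (fun t => f t * cos (n%:R * (x - t))).
Proof.
move=> fi; apply: (@itgM_bnd _ 1) => //; last by move=> t _; exact: cos_max.
by apply: meas_cos; apply: measurable_funM => //; apply: measurable_funB.
Qed.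

Lemma itgM_sin_shift f n (x : R) : itg f -> itg (fun t => f t * sin (n%:R * (x - t))).
Proof.
move=> fi; apply: (@itgM_bnd _ 1) => //; last by move=> t _; exact: sin_max.
by apply: meas_sin; apply: measurable_funM => //; apply: measurable_funB.
Qed.

Lemma sin_half_neq0 (x t : R) : C x -> C t -> t != x -> sin ((x - t) / 2) != 0.
Proof.
rewrite /circle/= !in_itv/= => /andP[x1 x2] /andP[t1 t2] tx.
have [h|h] : x - t > 0 \/ x - t < 0.
  by move: tx; rewrite neq_lt => /orP[] ?; [left|right]; lra.
  by rewrite gt_eqF// sin_gt0_pi//; apply/andP; split; lra.
rewrite -oppr_eq0 -sinN -mulNr gt_eqF// sin_gt0_pi//; apply/andP; split; lra.
Qed.

(** Dirichlet's formula: with w = u - u x, the kernel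
   sin ((n + 1/2) y) / sin (y / 2) is split into sin (n y) / tan (y / 2) and
   cos (n y), so that the error of the partial sum consists of Fourier
   coefficients of order n. *)
Lemma dirichlet_formula u v (x : R) n : primitive u v -> equal_ends u -> C x ->
  2 * pi * fourier_sum (fun t => u t - u x) n x + ccoef (fun t => u t - u x) 0 =
  (sin (n%:R * x) * ccoef (cauchy_diff u x) n - cos (n%:R * x) * scoef (cauchy_diff u x) n) +
  (cos (n%:R * x) * ccoef (fun t => u t - u x) n + sin (n%:R * x) * scoef (fun t => u t - u x) n).
Proof.
move=> p cu xC; set w := fun t => u t - u x; set q := cauchy_diff u x.
have qi : itg q by exact: itg_cauchy_diff p cu xC.
have wi : itg w.
  by apply: itgB => //; [exact: sqint_itg (primitive_sqint p)|exact: itg_cst].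
have pi0 : pi != 0 :> R by rewrite gt_eqF// pi_gt0.
elim: n => [|n IH].
  rewrite /fourier_sum /trig_poly big_geq// mulr0 !mul0r sin0 cos0 !scoef0.
  by ring.
rewrite -Rint_sin_shift// -Rint_cos_shift//.
have -> : fourier_sum w n.+1 x = fourier_sum w n x +
    pi^-1 * (ccoef w n.+1 * cos (n.+1%:R * x) + scoef w n.+1 * sin (n.+1%:R * x)).
  by rewrite /fourier_sum /trig_poly big_nat_recr//= mulrDr.
rewrite -Rint_sin_shift// -Rint_cos_shift// in IH.
have iqc := itgM_sin_shift n x qi; have iwc := itgM_cos_shift n x wi.
have iqs := itgM_sin_shift n.+1 x qi; have iws := itgM_cos_shift n.+1 x wi.
have -> : 2 * pi * (fourier_sum w n x +
    pi^-1 * (ccoef w n.+1 * cos (n.+1%:R * x) + scoef w n.+1 * sin (n.+1%:R * x))) +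
    ccoef w 0 = (2 * pi * fourier_sum w n x + ccoef w 0) +
    2 * (cos (n.+1%:R * x) * ccoef w n.+1 + sin (n.+1%:R * x) * scoef w n.+1).
  move: (fourier_sum _ _ _) (ccoef _ n.+1) (ccoef _ 0) (scoef _ _) (cos _) (sin _).
  by move=> a b c d e f; move: (pi : R) pi0 => z z0; field.
rewrite IH -Rint_cos_shift// -[RHS]RintegralD// -[X in X + _]RintegralD//.
rewrite -[X in _ + X]RintegralZl// -[LHS]RintegralD//; [|exact: itgD|exact: itgZ].
apply: eq_Rintegral => t; rewrite inE => tC.
have [->|tx] := eqVneq t x.
  by rewrite /q/w/cauchy_diff !subrr !mul0r; ring.
have := @cot_half_diff n (x - t) (sin_half_neq0 xC tC tx).
rewrite /q /cauchy_diff -/(w t).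
set s1 := sin (n.+1%:R * (x - t)); set s0 := sin (n%:R * (x - t)).
set c1 := cos (n.+1%:R * (x - t)); set c0 := cos (n%:R * (x - t)).
set T := (tan _)^-1; move=> /(congr1 (fun z => w t * z)).
move: (w t) s1 s0 c1 c0 T => W s1 s0 c1 c0 T /= h.
have -> : W * T * s1 = W * T * s0 + W * (c1 + c0) by rewrite -h; ring.
by ring.
Qed.

Lemma cvg0_bounded (b c : nat -> R) : (forall n, `|b n| <= 1) ->
  c n @[n --> \oo] --> (0 : R) -> b n * c n @[n --> \oo] --> (0 : R).
Proof.
move=> b1 /cvgr0Pnorm_lt c0; apply/cvgr0Pnorm_lt => e e0.
apply: filterS (c0 _ e0) => n h; apply: le_lt_trans h.
by rewrite normrM ler_piMl.
Qed.

(** Dini's criterion: the quotient [cauchy_diff u x] is integrable by Hoelder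
   continuity, so that the right-hand side of [dirichlet_formula] tends to 0 by
   the Riemann-Lebesgue lemma. The partial sums start at k = 1, whence the mean
   of u in the limit. *)
Lemma fourier_sum_cvg u v (x : R) : primitive u v -> equal_ends u -> C x ->
  fourier_sum u n x @[n --> \oo] --> u x - (\int[lam]_(t in C) u t) / (2 * pi).
Proof.
move=> p cu xC; set w := fun t => u t - u x; set q := cauchy_diff u x.
have qi : itg q by exact: itg_cauchy_diff p cu xC.
have ui : itg u by exact: sqint_itg (primitive_sqint p).
have wi : itg w by apply: itgB => //; exact: itg_cst.
have pi0 : pi != 0 :> R by rewrite gt_eqF// pi_gt0.
have [qc qs] := riemann_lebesgue qi; have [wc ws] := riemann_lebesgue wi.
have wk k : (0 < k)%N -> ccoef w k = ccoef u k /\ scoef w k = scoef u k.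
  move=> k0; rewrite /w ccoefB ?scoefB//; try exact: itg_cst.
  have ic : itg (fun t => cos (k%:R * t)) by apply: sqint_itg => //; exact: sqint_cosk.
  have is' : itg (fun t => sin (k%:R * t)) by apply: sqint_itg => //; exact: sqint_sink.
  rewrite [X in _ - X]/ccoef [X in _ /\ _ - X = _]/scoef !RintegralZl//.
  by rewrite Rint_cosk// Rint_sink mulr0 !subr0.
have fw n : fourier_sum w n x = fourier_sum u n x.
  congr (_ * _); apply: eq_big_nat => k /andP[k0 _].
  by have [-> ->] := wk k k0.
have w0 : ccoef w 0 = \int[lam]_(t in C) u t - 2 * pi * u x.
  by rewrite ccoef0 RintegralB ?Rint_circle_cst//; [ring|exact: itg_cst].
have E n : fourier_sum u n x = (u x - (\int[lam]_(t in C) u t) / (2 * pi)) + (2 * pi)^-1 *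
   ((sin (n%:R * x) * ccoef q n + - cos (n%:R * x) * scoef q n) +
    (cos (n%:R * x) * ccoef w n + sin (n%:R * x) * scoef w n)).
  have := dirichlet_formula n p cu xC; rewrite -/w -/q fw w0 => h.
  rewrite mulNr -h; move: (fourier_sum _ _ _) (\int[lam]_(t in C) u t) (u x).
  by move=> a b c; move: (pi : R) pi0 => z z0; field.
under eq_fun do rewrite E.
have sb (c : nat -> R) : c n @[n --> \oo] --> (0 : R) ->
    sin (n%:R * x) * c n @[n --> \oo] --> (0 : R).
  by apply: cvg0_bounded => n; exact: sin_max.
have cb (c : nat -> R) : c n @[n --> \oo] --> (0 : R) ->
    cos (n%:R * x) * c n @[n --> \oo] --> (0 : R).
  by apply: cvg0_bounded => n; exact: cos_max.
have ncb (c : nat -> R) : c n @[n --> \oo] --> (0 : R) ->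
    - cos (n%:R * x) * c n @[n --> \oo] --> (0 : R).
  by apply: cvg0_bounded => n; rewrite normrN; exact: cos_max.
have := cvgD (cvg_cst (u x - (\int[lam]_(t in C) u t) / (2 * pi)))
  (cvgM (cvg_cst (2 * pi)^-1)
    (cvgD (cvgD (sb _ qc) (ncb _ qs)) (cvgD (cb _ wc) (sb _ ws)))).
by rewrite !addr0 mulr0 addr0; apply.
Qed.

End pointwise_convergence.

(** * The conjugate function *)

Section conjugate_function.
Context {R : realType}.
Local Notation lam := (@lebesgue_measure R).
Local Notation C := (@circle R).
Local Notation itg f := (lam.-integrable C (EFin \o f)).
Local Notation L2 := (sqint lam C).
Implicit Types (f g u v h : R -> R) (a b : nat -> R).

Let mC := @measurable_circle R.
Let fC := @circle_fin R.

(** The multiplier i sgn k: cos (k x) goes to - sin (k x), and sin (k x) to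
   cos (k x). *)
Definition conjugate u (x : R) : R :=
  - ((2 * pi)^-1 * \int[lam]_(t in C) cauchy_diff u x t).

Let zeroC : C (0 : R).
Proof. by rewrite /circle/= in_itv/= oppr_lt0 pi_gt0 pi_ge0. Qed.

Let meas_half_cot : measurable_fun setT (fun y : R => (tan (y / 2))^-1).
Proof.
have m : measurable_fun setT (fun t : R => t / 2).
  by apply: measurable_funM => //; exact: measurable_id.
apply: measurable_funV; rewrite /tan; apply: measurable_funM; first exact: meas_sin.
by apply: measurable_funV; exact: meas_cos.
Qed.

Let half_cot_period (y : R) : (tan ((y + 2 * pi) / 2))^-1 = (tan (y / 2))^-1.
Proof. by rewrite -[in RHS]tanDpi; congr (tan _)^-1; field. Qed.

Let half_cot_odd (y : R) : (tan (- y / 2))^-1 = - (tan (y / 2))^-1.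
Proof. by rewrite mulNr tanN invrN. Qed.

Let itg_cos_cot (k : nat) : itg (fun y => (cos (k%:R * y) - 1) / tan (y / 2)).
Proof.
have := itgN (itg_cauchy_diff (primitive_cos k) (@equal_ends_cos _ k) zeroC).
congr (integrable _ _ _); apply/funext => y /=; congr EFin.
by rewrite /cauchy_diff mulr0 cos0 sub0r half_cot_odd mulrN opprK.
Qed.

Let itg_sin_cot (k : nat) : itg (fun y => sin (k%:R * y) / tan (y / 2)).
Proof.
have := itgN (itg_cauchy_diff (primitive_sin k) (@equal_ends_sin _ k) zeroC).
congr (integrable _ _ _); apply/funext => y /=; congr EFin.
by rewrite /cauchy_diff mulr0 sin0 sub0r subr0 half_cot_odd mulrN opprK.
Qed.

Let meas_cos_cot (k : nat) :
  measurable_fun setT (fun y : R => (cos (k%:R * y) - 1) / tan (y / 2)).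
Proof.
by apply: measurable_funM => //; apply: measurable_funB => //; exact: meas_cosk.
Qed.

Let meas_sin_cot (k : nat) :
  measurable_fun setT (fun y : R => sin (k%:R * y) / tan (y / 2)).
Proof. by apply: measurable_funM => //; exact: meas_sink. Qed.

Let Rint_cos_cot (k : nat) :
  \int[lam]_(y in C) ((cos (k%:R * y) - 1) / tan (y / 2)) = 0.
Proof.
apply: (@Rint_odd R (fun y => (cos (k%:R * y) - 1) / tan (y / 2))) => // y.
  by rewrite cos_period half_cot_period.
by rewrite mulrN cosN half_cot_odd mulrN.
Qed.

(** By [cot_half_diff], consecutive integrals differ by the integral of
   cos ((n + 1) y) + cos (n y), which is 2 pi for n = 0 and vanishes otherwise. *)
Let Rint_sin_cot (k : nat) :
  \int[lam]_(y in C) (sin (k.+1%:R * y) / tan (y / 2)) = 2 * pi.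
Proof.
have step n : \int[lam]_(y in C) (sin (n.+1%:R * y) / tan (y / 2)) =
    \int[lam]_(y in C) (sin (n%:R * y) / tan (y / 2)) +
    \int[lam]_(y in C) (cos (n.+1%:R * y) + cos (n%:R * y)).
  apply/eqP; rewrite addrC -subr_eq -RintegralB//; apply/eqP.
  apply: Rint_ae => //.
  - by apply: measurable_funTS; apply: measurable_funB; exact: meas_sin_cot.
  - by apply: measurable_funD; exact: meas_cosk.
  exists [set 0]; split => //; first exact: lebesgue_measure_set1.
  move=> y /= /not_implyP [yC]; apply: contra_notP => /eqP y0.
  have := sin_half_neq0 zeroC yC y0; rewrite sub0r mulNr sinN oppr_eq0 => s0.
  by rewrite -mulrBl cot_half_diff.
have ic n : itg (fun y => cos (n%:R * y)) by apply: sqint_itg => //; exact: sqint_cosk.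
elim: k => [|k IH]; rewrite step.
  rewrite (_ : \int[lam]_(y in C) (sin (0%:R * y) / tan (y / 2)) = 0); last first.
    under eq_Rintegral do rewrite mul0r sin0 mul0r.
    by rewrite Rint_circle_cst mul0r.
  rewrite RintegralD// Rint_cosk//.
  under eq_Rintegral do rewrite mul0r cos0.
  by rewrite Rint_circle_cst mul1r !add0r.
by rewrite IH RintegralD// !Rint_cosk// !addr0.
Qed.

(** Expanding cos (k t) = cos (k x - k (x - t)) splits the integrand into a
   part that is odd about x and a multiple of sin (k (x - t)) / tan ((x - t) / 2). *)
Lemma conjugate_cos (k : nat) (x : R) : (0 < k)%N -> C x ->
  conjugate (fun t => cos (k%:R * t)) x = - sin (k%:R * x).
Proof.
case: k => // k _ xC; rewrite /conjugate; congr (- _).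
pose F y := cos (k.+1%:R * x) * ((cos (k.+1%:R * y) - 1) / tan (y / 2)) +
            sin (k.+1%:R * x) * (sin (k.+1%:R * y) / tan (y / 2)).
have -> : \int[lam]_(t in C) cauchy_diff (fun t => cos (k.+1%:R * t)) x t =
    \int[lam]_(t in C) F (x - t).
  apply: eq_Rintegral => t _; rewrite /cauchy_diff /F !mulrA -mulrDl; congr (_ / _).
  by rewrite (_ : k.+1%:R * t = k.+1%:R * x - k.+1%:R * (x - t)) ?cosB; ring.
rewrite Rint_periodic//; last 2 first.
- by apply: measurable_funD; apply: measurable_funM.
- by move=> y; rewrite /F cos_period sin_period half_cot_period.
rewrite RintegralD//; [|exact: itgZ|exact: itgZ].
rewrite !RintegralZl// Rint_cos_cot Rint_sin_cot mulr0 add0r mulrCA mulVf ?mulr1//.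
by rewrite mulf_neq0// gt_eqF// pi_gt0.
Qed.

Lemma conjugate_sin (k : nat) (x : R) : (0 < k)%N -> C x ->
  conjugate (fun t => sin (k%:R * t)) x = cos (k%:R * x).
Proof.
case: k => // k _ xC; rewrite /conjugate.
pose F y := sin (k.+1%:R * x) * ((cos (k.+1%:R * y) - 1) / tan (y / 2)) +
            - cos (k.+1%:R * x) * (sin (k.+1%:R * y) / tan (y / 2)).
have -> : \int[lam]_(t in C) cauchy_diff (fun t => sin (k.+1%:R * t)) x t =
    \int[lam]_(t in C) F (x - t).
  apply: eq_Rintegral => t _; rewrite /cauchy_diff /F !mulrA -mulrDl; congr (_ / _).
  by rewrite (_ : k.+1%:R * t = k.+1%:R * x - k.+1%:R * (x - t)) ?sinB; ring.
rewrite Rint_periodic//; last 2 first.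
- by apply: measurable_funD; apply: measurable_funM.
- by move=> y; rewrite /F cos_period sin_period half_cot_period.
rewrite RintegralD//; [|exact: itgZ|exact: itgZ].
rewrite !RintegralZl// Rint_cos_cot Rint_sin_cot mulr0 add0r mulrCA mulVf ?mulr1 ?opprK//.
by rewrite mulf_neq0// gt_eqF// pi_gt0.
Qed.

Lemma primitive_trig_poly a b n : primitive (trig_poly a b n)
  (trig_poly (fun k => k%:R * b k) (fun k => - (k%:R * a k)) n).
Proof.
apply: primitiveZ; elim: n => [|n IH].
  under eq_fun do rewrite big_geq//; under [X in primitive _ X]eq_fun do rewrite big_geq//.
  exact: primitive_cst.
under eq_fun do rewrite big_nat_recr//=.
have -> : (fun x => \sum_(1 <= k < n.+2)
     (k%:R * b k * cos (k%:R * x) + - (k%:R * a k) * sin (k%:R * x))) =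
   (fun x => (\sum_(1 <= k < n.+1)
     (k%:R * b k * cos (k%:R * x) + - (k%:R * a k) * sin (k%:R * x))) +
     (a n.+1 * (n.+1%:R * - sin (n.+1%:R * x)) + b n.+1 * (n.+1%:R * cos (n.+1%:R * x)))).
  by apply/funext => x; rewrite big_nat_recr//=; congr (_ + _); ring.
apply: primitiveD => //; apply: primitiveD; apply: primitiveZ.
  exact: primitive_cos.
exact: primitive_sin.
Qed.

Lemma equal_ends_trig_poly a b n : equal_ends (trig_poly a b n).
Proof.
rewrite /equal_ends /trig_poly; congr (_ * _); apply: eq_bigr => k _.
by rewrite (@equal_ends_cos R k) (@equal_ends_sin R k).
Qed.

Lemma conjugate_trig_poly a b n (x : R) : C x ->
  conjugate (trig_poly a b n) x = trig_poly b (fun k => - a k) n x.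
Proof.
move=> xC; rewrite /conjugate.
have -> : \int[lam]_(t in C) cauchy_diff (trig_poly a b n) x t =
    \int[lam]_(t in C) (pi^-1 * \sum_(1 <= k < n.+1)
      (a k * cauchy_diff (fun t => cos (k%:R * t)) x t +
       b k * cauchy_diff (fun t => sin (k%:R * t)) x t)).
  apply: eq_Rintegral => t _; rewrite /cauchy_diff /trig_poly -mulrBr -mulrA; congr (_ * _).
  rewrite -sumrB mulr_suml; apply: eq_bigr => k _; ring.
have ick k : itg (cauchy_diff (fun t => cos (k%:R * t)) x).
  exact: itg_cauchy_diff (primitive_cos k) (@equal_ends_cos _ k) xC.
have isk k : itg (cauchy_diff (fun t => sin (k%:R * t)) x).
  exact: itg_cauchy_diff (primitive_sin k) (@equal_ends_sin _ k) xC.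
have ik k : itg (fun t => a k * cauchy_diff (fun t => cos (k%:R * t)) x t +
       b k * cauchy_diff (fun t => sin (k%:R * t)) x t).
  by apply: itgD => //; exact: itgZ.
rewrite RintegralZl//; last exact: itg_sum.
rewrite Rint_sum// -!mulrN mulrCA /trig_poly; congr (_ * _).
rewrite -sumrN mulr_sumr; apply: eq_big_nat => k /andP[k0 _].
rewrite RintegralD//; [|exact: itgZ|exact: itgZ].
have hc := conjugate_cos k0 xC; have hs := conjugate_sin k0 xC.
rewrite /conjugate in hc hs.
rewrite !RintegralZl// -hs.
have -> : sin (k%:R * x) = (2 * pi)^-1 * \int[lam]_(t in C) cauchy_diff (fun t => cos (k%:R * t)) x t.
  by apply: oppr_inj; rewrite hc.
by ring.
Qed.

(** Uniformity in x and the sole dependence on the energy of u' make this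
   bound a dominating function for the conjugates of all partial sums of u. *)
Lemma le_conjugate u v (x : R) : primitive u v -> equal_ends u -> C x ->
  `|conjugate u x| <= (2 * pi)^-1 *
    (Num.sqrt (8 * \int[lam]_(s in C) (v s ^+ 2)) * \int[lam]_(t in C) weak_kernel t).
Proof.
move=> p cu xC; have pi0 := @pi_gt0 R.
have c0 : 0 <= (2 * pi)^-1 :> R by rewrite invr_ge0; lra.
rewrite /conjugate normrN normrM ger0_norm//; apply: ler_wpM2l => //.
have iq := itg_cauchy_diff p cu xC.
have [ik <-] := itg_weak_kernel_shift xC.
apply: (le_trans (le_normr_Rintegral mC iq)); rewrite -RintegralZl//.
apply: le_Rintegral => //; [exact: itg_abs|exact: itgZ|].
by move=> t tC; exact: cauchy_diff_le.
Qed.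

Lemma fourier_sum_primitive u v n : primitive u v -> equal_ends u ->
  primitive (fourier_sum u n) (fourier_sum v n).
Proof.
move=> p cu; have := primitive_trig_poly (ccoef u) (scoef u) n.
congr primitive; apply/funext => x; congr (_ * _); apply: eq_bigr => k _.
by rewrite (ccoef_primitive k p cu) (scoef_primitive k p cu).
Qed.

Lemma fourier_sum_energy_le v n : L2 v ->
  \int[lam]_(x in C) (fourier_sum v n x ^+ 2) <= \int[lam]_(x in C) (v x ^+ 2).
Proof. by move=> v2; rewrite trig_poly_sqnorm; exact: bessel. Qed.

(** Dominated convergence: by the Bessel inequality, the partial sums of u
   share the Hoelder constant of u. *)
Lemma conjugate_fourier_sum_cvg u v (x : R) : primitive u v -> equal_ends u -> C x ->
  conjugate (fourier_sum u n) x @[n --> \oo] --> conjugate u x.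
Proof.
move=> p cu xC; have v2 : L2 v by case: p.
apply: cvgN; apply: cvgM; first exact: cvg_cst.
have [ik _] := itg_weak_kernel_shift xC.
apply: (proj2 (@Rint_dominated _ _ _ lam C mC _ _
   (fun t => Num.sqrt (8 * \int[lam]_(s in C) (v s ^+ 2)) * weak_kernel (x - t)) _ _ _ _)).
- move=> n; apply: meas_cauchy_diff.
  exact: primitive_measurable (fourier_sum_primitive n p cu).
- move=> t tC; apply: cvgM; last exact: cvg_cst.
  have := cvgB (fourier_sum_cvg p cu tC) (fourier_sum_cvg p cu xC).
  by rewrite opprB addrA subrK; apply.
- exact: itgZ.
- move=> n t tC.
  apply: (le_trans (cauchy_diff_le (fourier_sum_primitive n p cu) _ xC tC)).
    exact: equal_ends_trig_poly.
  apply: ler_wpM2r; first exact: weak_kernel_ge0.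
  by rewrite ler_wsqrtr// ler_wpM2l//; exact: fourier_sum_energy_le.
Qed.

Lemma measurable_conjugate u v : primitive u v -> equal_ends u -> measurable_fun C (conjugate u).
Proof.
move=> p cu; apply: (@measurable_fun_cvg _ _ _ _
  (fun n => trig_poly (scoef u) (fun k => - ccoef u k) n)).
  by move=> n; have [] := sqint_trig_poly (scoef u) (fun k => - ccoef u k) n.
move=> x xC; have := conjugate_fourier_sum_cvg p cu xC.
by under eq_fun do rewrite conjugate_trig_poly//.
Qed.

Lemma sqint_conjugate u v : primitive u v -> equal_ends u -> L2 (conjugate u).
Proof.
move=> p cu; apply: (sqint_bnd mC fC (measurable_conjugate p cu)) => x.
exact: (le_conjugate p cu).
Qed.

(** The left-hand side is \int H(S_n u) h for the partial sums S_n u of u. *)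
Lemma conjugate_inner_cvg u v h : primitive u v -> equal_ends u -> L2 h ->
  pi^-1 * \sum_(1 <= k < n.+1) (scoef u k * ccoef h k - ccoef u k * scoef h k)
    @[n --> \oo] --> \int[lam]_(x in C) (conjugate u x * h x).
Proof.
move=> p cu h2; have v2 : L2 v by case: p.
set K := (2 * pi)^-1 *
    (Num.sqrt (8 * \int[lam]_(s in C) (v s ^+ 2)) * \int[lam]_(t in C) weak_kernel t).
have hi : itg h by exact: sqint_itg.
have E n : \int[lam]_(x in C) (conjugate (fourier_sum u n) x * h x) =
   pi^-1 * \sum_(1 <= k < n.+1) (scoef u k * ccoef h k - ccoef u k * scoef h k).
  transitivity (\int[lam]_(x in C)
      (trig_poly (scoef u) (fun k => - ccoef u k) n x * h x)).
    by apply: eq_Rintegral => x; rewrite inE => xC; rewrite conjugate_trig_poly.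
  rewrite trig_poly_inner//; congr (_ * _); apply: eq_bigr => k _.
  by rewrite mulNr.
under eq_fun do rewrite -E.
apply: (proj2 (@Rint_dominated _ _ _ lam C mC
   (fun n x => conjugate (fourier_sum u n) x * h x) (fun x => conjugate u x * h x)
   (fun x => K * `|h x|) _ _ _ _)).
- move=> n; apply: measurable_funM; last by case: h2.
  apply: measurable_conjugate (fourier_sum_primitive n p cu) _.
  exact: equal_ends_trig_poly.
- move=> x xC; apply: cvgM; last exact: cvg_cst.
  exact: conjugate_fourier_sum_cvg p cu xC.
- by apply: itgZ => //; exact: itg_abs.
- move=> n x xC; rewrite normrM; apply: ler_wpM2r => //.
  apply: (le_trans (le_conjugate (fourier_sum_primitive n p cu) _ xC)).
    exact: equal_ends_trig_poly.
  rewrite /K; apply: ler_wpM2l; first by rewrite invr_ge0; have := @pi_gt0 R; lra.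
  apply: ler_wpM2r; first by apply: Rintegral_ge0 => t _; exact: weak_kernel_ge0.
  by rewrite ler_wsqrtr// ler_wpM2l//; exact: fourier_sum_energy_le.
Qed.

End conjugate_function.

(** * Parseval formula and uniqueness of Fourier coefficients *)

Section parseval_and_uniqueness.
Context {R : realType}.
Local Notation lam := (@lebesgue_measure R).
Local Notation C := (@circle R).
Local Notation itg f := (lam.-integrable C (EFin \o f)).
Local Notation L2 := (sqint lam C).
Implicit Types (f g u v h : R -> R).

Let mC := @measurable_circle R.
Let fC := @circle_fin R.
Let pi_neq0 : pi != 0 :> R. Proof. by rewrite gt_eqF// pi_gt0. Qed.

Lemma conjugate_coef u v (k : nat) : primitive u v -> equal_ends u -> (0 < k)%N ->
  ccoef (conjugate u) k = scoef u k /\ scoef (conjugate u) k = - ccoef u k.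
Proof.
move=> p cu k0.
have ev (F : nat -> R) (l m : R) : F n @[n --> \oo] --> l ->
    (forall n, (k <= n)%N -> F n = m) -> l = m.
  move=> Fl Fm; rewrite -(cvg_lim (@norm_hausdorff _ _) Fl).
  apply: lim_near_cst; first exact: norm_hausdorff.
  by near=> n; apply: Fm; near: n; exact: nbhs_infty_ge.
split.
- apply: (ev _ _ _ (conjugate_inner_cvg p cu (sqint_cosk k))) => n kn.
  rewrite (bigD1_seq k) ?iota_uniq ?mem_index_iota ?k0//=.
  rewrite big1_seq ?addr0; last first.
    move=> j /andP[jk]; rewrite mem_index_iota => /andP[j0 _].
    rewrite scoef_cos (proj1 (cos_sin_orthogonal k j0)) eq_sym (negbTE jk).
    by rewrite mulr0n !mulr0 subr0.
  rewrite scoef_cos (proj1 (cos_sin_orthogonal k k0)) eqxx mulr1n mulr0 subr0.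
  by rewrite mulrCA mulVf ?mulr1.
- apply: (ev _ _ _ (conjugate_inner_cvg p cu (sqint_sink k))) => n kn.
  rewrite (bigD1_seq k) ?iota_uniq ?mem_index_iota ?k0//=.
  rewrite big1_seq ?addr0; last first.
    move=> j /andP[jk]; rewrite mem_index_iota => /andP[j0 _].
    rewrite ccoef_sin (proj2 (cos_sin_orthogonal k j0)) eq_sym (negbTE jk).
    by rewrite mulr0n !mulr0 subr0.
  rewrite ccoef_sin (proj2 (cos_sin_orthogonal k k0)) eqxx mulr1n mulr0 sub0r.
  by rewrite mulrN mulrCA mulVf ?mulr1.
Unshelve. all: by end_near. Qed.

(** This integral is (1 / pi) sum_k k (a_k^2 + b_k^2), where a_k and b_k are the
   integrals of u against cos (k x) and sin (k x). *)
Lemma conjugate_inner_derivative_ge0 u v : primitive u v -> equal_ends u ->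
  0 <= \int[lam]_(x in C) (conjugate u x * v x).
Proof.
move=> p cu; have v2 : L2 v by case: p.
have cv := conjugate_inner_cvg p cu v2.
rewrite -(cvg_lim _ cv)//; apply: limr_ge; first by apply/cvg_ex; eexists; exact: cv.
near=> n; apply: mulr_ge0; first by rewrite invr_ge0 pi_ge0.
apply: sumr_ge0 => k _; rewrite (ccoef_primitive k p cu) (scoef_primitive k p cu).
have := sqr_ge0 (scoef u k); have := sqr_ge0 (ccoef u k); have : 0 <= k%:R :> R by [].
by move=> ? ? ?; rewrite mulrN opprK !(mulrCA _ k%:R) -mulrDr mulr_ge0// -!expr2 addr_ge0.
Unshelve. all: by end_near. Qed.

(** The partial sums of u converge to u up to its mean, which the mean-zero
   function h does not see; they are bounded uniformly, having a common Hoelder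
   constant and converging at 0. *)
Lemma parseval u v h : primitive u v -> equal_ends u -> L2 h -> \int[lam]_(x in C) h x = 0 ->
  pi^-1 * \sum_(1 <= k < n.+1) (ccoef u k * ccoef h k + scoef u k * scoef h k)
    @[n --> \oo] --> \int[lam]_(x in C) (u x * h x).
Proof.
move=> p cu h2 h0; have v2 : L2 v by case: p.
have u2 := primitive_sqint p.
set m := (\int[lam]_(t in C) u t) / (2 * pi).
set E := \int[lam]_(s in C) (v s ^+ 2).
have hi : itg h by exact: sqint_itg.
have zC : C (0 : R) by rewrite /circle/= in_itv/= oppr_lt0 pi_gt0 pi_ge0.
have [B SB] : exists B : R, forall n, `|fourier_sum u n 0| <= B.
  have cS : cvgn (fun n => fourier_sum u n 0).
    by apply/cvg_ex; eexists; exact: fourier_sum_cvg p cu zC.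
  have /pinfty_ex_gt0[B _ /= hB] := cvg_seq_bounded cS.
  by exists B => n; exact: hB.
have bnd n x : C x -> `|fourier_sum u n x| <= B + Num.sqrt (8 * E).
  move=> xC; rewrite -(subrK (fourier_sum u n 0) (fourier_sum u n x)) addrC.
  apply: (le_trans (ler_normD _ _)); apply: lerD => //.
  rewrite -sqrtr_sqr ler_wsqrtr//.
  apply: (le_trans (primitive_circle_holder (fourier_sum_primitive n p cu) _ zC xC)).
    exact: equal_ends_trig_poly.
  apply: (@le_trans _ _ (8 * \int[lam]_(s in C) (fourier_sum v n s ^+ 2))).
    rewrite ler_piMr ?sin_max// mulr_ge0//; exact: Rint_sqr_ge0.
  by rewrite ler_wpM2l//; exact: fourier_sum_energy_le.
have -> : \int[lam]_(x in C) (u x * h x) = \int[lam]_(x in C) ((u x - m) * h x).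
  transitivity (\int[lam]_(x in C) (u x * h x) - \int[lam]_(x in C) (m * h x)).
    by rewrite RintegralZl// h0 mulr0 subr0.
  rewrite -RintegralB//; [|exact: sqint_itgM|exact: itgZ].
  by apply: eq_Rintegral => x _; rewrite mulrBl.
have Ee n : \int[lam]_(x in C) (fourier_sum u n x * h x) =
   pi^-1 * \sum_(1 <= k < n.+1) (ccoef u k * ccoef h k + scoef u k * scoef h k).
  exact: trig_poly_inner.
under eq_fun do rewrite -Ee.
apply: (proj2 (@Rint_dominated _ _ _ lam C mC
   (fun n x => fourier_sum u n x * h x) (fun x => (u x - m) * h x)
   (fun x => (B + Num.sqrt (8 * E)) * `|h x|) _ _ _ _)).
- move=> n; apply: measurable_funM; last by case: h2.
  by have [] := sqint_trig_poly (ccoef u) (scoef u) n.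
- move=> x xC; apply: cvgM; last exact: cvg_cst.
  exact: fourier_sum_cvg p cu xC.
- by apply: itgZ => //; exact: itg_abs.
- by move=> n x xC; rewrite normrM; apply: ler_wpM2r => //; exact: bnd.
Qed.

(** The primitive of w is constant, since its Fourier series converges to it
   everywhere; then w is recovered by Lebesgue differentiation. *)
Lemma fourier_uniqueness w : L2 w ->
  (forall k, ccoef w k = 0) -> (forall k, scoef w k = 0) ->
  {ae lam, forall x, C x -> w x = 0}.
Proof.
move=> w2 cw sw; have wi : itg w by exact: sqint_itg.
have pi0 := @pi_gt0 R.
pose W x := 0 + \int[lam]_(t in `]- pi, x]) w t.
have p : primitive W w by exact: primitive_exists.
have cW : equal_ends W.
  rewrite /equal_ends /W; congr (_ + _); rewrite set_itvoc0 Rintegral_set0.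
  by rewrite -[RHS](cw 0) ccoef0.
set m := (\int[lam]_(t in C) W t) / (2 * pi).
have Wm x : C x -> W x = m.
  move=> xC; have := fourier_sum_cvg p cW xC.
  have -> : (fun n => fourier_sum W n x) = fun=> 0.
    apply/funext => n; rewrite /fourier_sum /trig_poly big1_seq ?mulr0// => k.
    rewrite mem_index_iota => /= /andP[k0 _].
    have kr0 : k%:R != 0 :> R by rewrite pnatr_eq0 -lt0n.
    have := ccoef_primitive k p cW; rewrite cw => /esym/eqP.
    rewrite mulf_eq0 (negbTE kr0) => /eqP ->.
    have := scoef_primitive k p cW; rewrite sw => /esym/eqP.
    rewrite oppr_eq0 mulf_eq0 (negbTE kr0) => /eqP ->.
    by rewrite !mul0r addr0.
  move=> /(cvg_lim (@norm_hausdorff _ _)); rewrite lim_cst; last exact: norm_hausdorff.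
  by move=> h; apply/eqP; rewrite -subr_eq0 -h.
pose w0 : R -> R := w \_ C.
have w0i : lam.-integrable setT (EFin \o w0).
  have /(integrable_mkcond _ mC) := wi.
  by rewrite restrict_EFin.
have w0y (y : R) : lam.-integrable [set` Interval (BRight (- pi)) (BRight y)] (EFin \o w0).
  exact: integrableS w0i.
have fae := FTC1 w0y (integrable_locally mC wi).
have pin : lam.-negligible [set (pi : R)].
  by exists [set pi]; split => //; exact: lebesgue_measure_set1.
have npi : {ae lam, forall x : R, x <> pi}.
  by apply: negligibleS pin => x /= /contrapT.
have aeF := ae_filter_ringOfSetsType lam.
apply: filterS2 npi fae => x /= xpi h xC.
have xI : x \in `]- pi, pi[.
  move: xC; rewrite /circle/= !in_itv/= => /andP[-> xp]/=.
  by rewrite lt_neqAle xp andbT; apply/eqP.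
have xl : (BRight (- pi) < BRight x)%O by move: xI; rewrite in_itv/= => /andP[].
have [_] := h xl.
have -> : w0 x = w x by rewrite /w0 patchE mem_set.
move=> <-; rewrite derive1E -(derive_cst m x 1).
apply: near_eq_derive.
near=> y.
have yI : y \in `]- pi, pi[ by near: y; exact: near_in_itvoo.
have yC : C y by move: yI; rewrite /circle/= !in_itv/= => /andP[-> /ltW].
rewrite -(Wm _ yC) /W add0r; apply: eq_Rintegral => t; rewrite inE => tI.
rewrite /w0 patchE mem_set//; apply: sub_circle tI => //.
by move: yC; rewrite /circle/= in_itv/= => /andP[].
Unshelve. all: by end_near. Qed.

End parseval_and_uniqueness.

(** * Weak derivatives and principal values *)

Section weak_derivatives.
Context {R : realType}.
Local Notation lam := (@lebesgue_measure R).
Local Notation C := (@circle R).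
Local Notation itg f := (lam.-integrable C (EFin \o f)).
Local Notation L2 := (sqint lam C).
Implicit Types (f g u v : R -> R).

Let mC := @measurable_circle R.
Let fC := @circle_fin R.

Let trig (k : nat) (a b : R) (x : R) := a * cos (k%:R * x) + b * sin (k%:R * x).

Let is_derive_trig k (a b x : R) :
  is_derive x 1 (trig k a b) (trig k (k%:R * b) (- (k%:R * a)) x).
Proof.
have dk : is_derive x 1 (fun y : R => k%:R * y) k%:R.
  by apply: is_derive_eq; rewrite /GRing.scale/=; ring.
have dc : is_derive x 1 (fun y => cos (k%:R * y)) (k%:R * - sin (k%:R * x)).
  by apply: is_derive_eq; rewrite /GRing.scale/=; ring.
have ds : is_derive x 1 (fun y => sin (k%:R * y)) (k%:R * cos (k%:R * x)).
  by apply: is_derive_eq; rewrite /GRing.scale/=; ring.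
by rewrite /trig; apply: is_derive_eq; rewrite /GRing.scale/=; ring.
Qed.

Let derive_trig k a b : (trig k a b)^`()%classic = trig k (k%:R * b) (- (k%:R * a)).
Proof. by apply/funext => x; rewrite derive1E; case: (is_derive_trig k a b x). Qed.

Let smooth_trig k a b : smooth_periodic (trig k a b).
Proof.
split=> [x|n x]; first by rewrite /trig cos_period sin_period.
have [a' [b' ->]] : exists a' b' : R, (trig k a b)^`(n)%classic = trig k a' b'.
  elim: n => [|n [a' [b' IH]]]; first by exists a, b.
  by exists (k%:R * b'), (- (k%:R * a')); rewrite derive1nS IH derive_trig.
by case: (is_derive_trig k a' b' x).
Qed.

(** Test functions cos (k x) and sin (k x). *)
Lemma weak_derivative_coef f g (k : nat) : L2 f -> L2 g -> weak_derivative f g ->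
  ccoef g k = k%:R * scoef f k /\ scoef g k = - (k%:R * ccoef f k).
Proof.
move=> f2 g2 fg; have fi := sqint_itg mC fC f2.
split.
- have := fg _ (smooth_trig k 1 0); rewrite derive_trig.
  have -> : \int[lam]_(x in C) (g x * trig k 1 0 x) = ccoef g k.
    by apply: eq_Rintegral => x _; rewrite /trig mul1r mul0r addr0.
  have -> : \int[lam]_(x in C) (f x * trig k (k%:R * 0) (- (k%:R * 1)) x) =
     - (k%:R * scoef f k).
    rewrite -[RHS]mulNr /scoef -RintegralZl//; last exact: itgM_sink.
    by apply: eq_Rintegral => x _; rewrite /trig; ring.
  by move/oppr_inj => ->.
- have := fg _ (smooth_trig k 0 1); rewrite derive_trig.
  have -> : \int[lam]_(x in C) (g x * trig k 0 1 x) = scoef g k.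
    by apply: eq_Rintegral => x _; rewrite /trig mul1r mul0r add0r.
  have -> : \int[lam]_(x in C) (f x * trig k (k%:R * 1) (- (k%:R * 0)) x) =
     k%:R * ccoef f k.
    rewrite /ccoef -RintegralZl//; last exact: itgM_cosk.
    by apply: eq_Rintegral => x _; rewrite /trig; ring.
  by move=> ->; rewrite opprK.
Qed.

Lemma ae_eq_of_coef f g : L2 f -> L2 g ->
  (forall k, ccoef f k = ccoef g k) -> (forall k, scoef f k = scoef g k) ->
  {ae lam, forall x, C x -> f x = g x}.
Proof.
move=> f2 g2 cfg sfg.
have aeF := ae_filter_ringOfSetsType lam.
have : {ae lam, forall x, C x -> f x - g x = 0}.
  have fi := sqint_itg mC fC f2; have gi := sqint_itg mC fC g2.
  apply: fourier_uniqueness; first exact: sqintB.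
  - by move=> k; rewrite ccoefB// cfg subrr.
  - by move=> k; rewrite scoefB// sfg subrr.
by apply: filterS => x h xC; apply/eqP; rewrite -subr_eq0 h.
Qed.

Lemma weak_derivative_unique f g g' : L2 f -> L2 g -> L2 g' ->
  weak_derivative f g -> weak_derivative f g' -> {ae lam, forall x, C x -> g x = g' x}.
Proof.
move=> f2 g2 g2' fg fg'; apply: ae_eq_of_coef => // k.
- by rewrite (proj1 (weak_derivative_coef k f2 g2 fg)) (proj1 (weak_derivative_coef k f2 g2' fg')).
- by rewrite (proj2 (weak_derivative_coef k f2 g2 fg)) (proj2 (weak_derivative_coef k f2 g2' fg')).
Qed.

(** A primitive of g with the same mean as f has the same Fourier
   coefficients as f. *)
Lemma weak_derivative_primitive f g : L2 f -> L2 g -> weak_derivative f g ->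
  exists u, [/\ primitive u g, equal_ends u & {ae lam, forall x, C x -> f x = u x}].
Proof.
move=> f2 g2 fg; have fi := sqint_itg mC fC f2.
have p0 := primitive_exists 0 g2; set P := (fun x => 0 + _) in p0.
have P2 := primitive_sqint p0; have Pi := sqint_itg mC fC P2.
pose c := (\int[lam]_(x in C) f x - \int[lam]_(x in C) P x) / (2 * pi).
have p : primitive (fun x => c + P x) g.
  have := primitiveD (primitive_cst c) p0.
  by congr primitive; apply/funext => x; rewrite add0r.
have cu : equal_ends (fun x => c + P x).
  rewrite /equal_ends /P set_itvoc0 Rintegral_set0; do 2 congr (_ + _).
  have := proj1 (weak_derivative_coef 0 f2 g2 fg); rewrite mul0r ccoef0.
  by [].
exists (fun x => c + P x); split => //.
have u2 := primitive_sqint p.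
apply: ae_eq_of_coef => // -[|k].
- rewrite !ccoef0 RintegralD//; last exact: itg_cst.
  rewrite Rint_circle_cst /c divfK ?subrK//.
  by rewrite mulf_neq0// gt_eqF// pi_gt0.
- have kr0 : k.+1%:R != 0 :> R by rewrite pnatr_eq0.
  apply: (mulfI kr0); apply: oppr_inj.
  rewrite -(scoef_primitive k.+1 p cu).
  by rewrite (proj2 (weak_derivative_coef k.+1 f2 g2 fg)).
- by rewrite !scoef0.
- have kr0 : k.+1%:R != 0 :> R by rewrite pnatr_eq0.
  apply: (mulfI kr0); rewrite -(ccoef_primitive k.+1 p cu).
  by rewrite (proj1 (weak_derivative_coef k.+1 f2 g2 fg)).
Qed.

End weak_derivatives.

Section principal_value.
Context {R : realType}.
Local Notation lam := (@lebesgue_measure R).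
Local Notation C := (@circle R).
Local Notation itg f := (lam.-integrable C (EFin \o f)).
Implicit Types (f g u v : R -> R).

Let mC := @measurable_circle R.
Let fC := @circle_fin R.

Lemma circle_distE (x t : R) : circle_dist x t = 2 * `|sin ((x - t) / 2)|.
Proof.
rewrite /circle_dist.
have -> : (cos x - cos t) ^+ 2 + (sin x - sin t) ^+ 2 = (2 * sin ((x - t) / 2)) ^+ 2.
  have h := cos_mulr2n ((x - t) / 2).
  rewrite (_ : (x - t) / 2 *+ 2 = x - t) in h; last by rewrite -mulr_natr; field.
  rewrite cosB cos2sin2 -mulr_natr in h.
  have h1 := cos2Dsin2 x; have h2 := cos2Dsin2 t.
  by lra.
by rewrite sqrtr_sqr normrM ger0_norm.
Qed.

(** Away from x, the truncated kernel is odd about x and integrates to zero,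
   so that [u x] may be subtracted from the density; what remains converges
   absolutely. *)
Lemma hilbert_transformE f u v (x : R) : primitive u v -> equal_ends u ->
  measurable_fun C f -> {ae lam, forall t, C t -> f t = u t} -> C x ->
  hilbert_transform f x = conjugate u x.
Proof.
move=> p cu mf fu xC; rewrite /hilbert_transform /conjugate; congr (- _).
have pi0 := @pi_gt0 R.
have q_i := itg_cauchy_diff p cu xC.
have mu := primitive_measurable p.
pose chi (e t : R) : R := if e < 2 * `|sin (t / 2)| then 1 else 0.
have mchi e : measurable_fun setT (chi e).
  apply: measurable_fun_ifT => //; apply: measurable_fun_ltr => //.
  apply: measurable_funM => //; apply: measurableT_comp => //; apply: meas_sin.
  by apply: measurable_funM => //; exact: measurable_id.
have mchi' e : measurable_fun setT (fun t : R => chi e (x - t)).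
  apply: (measurableT_comp (mchi e)).
  by apply: measurable_funB => //; exact: measurable_id.
have chi1 e t : `|chi e t| <= 1 by rewrite /chi; case: ifP; rewrite ?normr1 ?normr0.
have mcot : measurable_fun setT (fun y : R => (tan (y / 2))^-1).
  have := @meas_tan R setT 0 => h.
  have -> : (fun y : R => (tan (y / 2))^-1) = (fun y => - (tan ((0 - y) / 2))^-1).
    by apply/funext => y; rewrite sub0r mulNr tanN invrN opprK.
  exact: measurable_funN.
have chi_cot e y : 0 < e -> `|chi e y * (tan (y / 2))^-1| <= 2 / e.
  move=> e0; rewrite /chi; case: ifP => [h|_]; last first.
    by rewrite mul0r normr0 divr_ge0// ltW.
  rewrite mul1r /tan invf_div normrM normfV.
  have s0 : 0 < `|sin (y / 2)| by lra.
  by rewrite ler_pdivrMr// (le_trans (cos_max _))// mulrAC ler_pdivlMr// mul1r ltW.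
have key e : 0 < e ->
   \int[lam]_(t in C `&` [set t | e < circle_dist x t]) (f t / tan ((x - t) / 2) / (2 * pi)) =
   (2 * pi)^-1 * \int[lam]_(t in C) (chi e (x - t) * cauchy_diff u x t).
  move=> e0; rewrite Rintegral_mkcondr.
  have mk : measurable_fun C (fun t => chi e (x - t) * (tan ((x - t) / 2))^-1).
    apply: measurable_funM; last exact: meas_tan.
    exact: measurable_funTS.
  have ik : itg (fun t => chi e (x - t) * (tan ((x - t) / 2))^-1).
    by apply: (itg_bnd mC fC mk (M := 2 / e)) => t _; apply: chi_cot.
  have ick : itg (fun t => chi e (x - t) * cauchy_diff u x t).
    apply: (@itg_le _ _ _ _ _ mC _ (fun t => `|cauchy_diff u x t|)).
    - by apply: measurable_funM; [exact: (measurable_funTS (mchi' e))|exact: meas_cauchy_diff].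
    - by move=> t _; rewrite normrM ler_piMl.
    - exact: itg_abs.
  have k0 : \int[lam]_(t in C) (chi e (x - t) * (tan ((x - t) / 2))^-1) = 0.
    have mF : measurable_fun setT (fun y => chi e y * (tan (y / 2))^-1).
      exact: measurable_funM.
    have pF y : chi e (y + 2 * pi) * (tan ((y + 2 * pi) / 2))^-1 = chi e y * (tan (y / 2))^-1.
      rewrite /chi sin_half_period normrN; congr (_ * _^-1).
      by rewrite -[in RHS]tanDpi; congr tan; field.
    rewrite (@Rint_periodic R x (fun y => chi e y * (tan (y / 2))^-1))//.
    apply: (@Rint_odd R (fun y => chi e y * (tan (y / 2))^-1)) => // y.
    by rewrite /chi mulNr sinN normrN tanN invrN mulrN.
  transitivity (\int[lam]_(t in C) ((2 * pi)^-1 * (chi e (x - t) * cauchy_diff u x t +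
     u x * (chi e (x - t) * (tan ((x - t) / 2))^-1)))).
    transitivity (\int[lam]_(t in C) ((2 * pi)^-1 * (f t * (chi e (x - t) * (tan ((x - t) / 2))^-1)))).
      apply: eq_Rintegral => t _; rewrite patchE /chi -circle_distE.
      have -> : (t \in [set t | e < circle_dist x t]) = (e < circle_dist x t).
        by apply/idP/idP; rewrite inE.
      case: ifP => _ /=; first by rewrite mul1r [RHS]mulrC.
      by rewrite mul0r !mulr0.
    apply: Rint_ae => //.
    - by apply: measurable_funM => //; exact: measurable_funM.
    - apply: measurable_funM => //; apply: measurable_funD; first exact: itg_meas ick.
      by apply: measurable_funM.
    have aeF := ae_filter_ringOfSetsType lam.
    apply: filterS fu => t h tC; rewrite h// /cauchy_diff.
    by ring.
  rewrite RintegralZl//; last by apply: itgD => //; exact: itgZ.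
  rewrite RintegralD//; last exact: itgZ.
  by rewrite RintegralZl// k0 mulr0 addr0.
apply: cvg_lim => //; apply/cvg_at_rightP => e [e0 ecv].
have -> : (fun n => \int[lam]_(t in C `&` [set t | e n < circle_dist x t])
    (f t / tan ((x - t) / 2) / (2 * pi))) =
  (fun n => (2 * pi)^-1 * \int[lam]_(t in C) (chi (e n) (x - t) * cauchy_diff u x t)).
  by apply/funext => n; rewrite key.
apply: cvgM; first exact: cvg_cst.
apply: (proj2 (@Rint_dominated _ _ _ lam C mC _ _ (fun t => `|cauchy_diff u x t|) _ _ _ _)).
- move=> n; apply: measurable_funM; first exact: (measurable_funTS (mchi' (e n))).
  exact: meas_cauchy_diff.
- move=> t tC; have [->|tx] := eqVneq t x.
    have -> : cauchy_diff u x x = 0 by rewrite /cauchy_diff [u x - u x]subrr mul0r.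
    by under eq_fun do rewrite mulr0; exact: cvg_cst.
  have s0 := sin_half_neq0 xC tC tx.
  rewrite -[cauchy_diff u x t in X in _ --> X]mul1r; apply: cvgM; last exact: cvg_cst.
  have d0 : 0 < 2 * `|sin ((x - t) / 2)| by rewrite mulr_gt0// normr_gt0.
  apply: cvg_near_cst; near=> n; rewrite /chi ifT//.
  by near: n; apply: cvgr_lt ecv _ d0.
- exact: itg_abs.
- by move=> n t _; rewrite normrM ler_piMl.
Unshelve. all: by end_near. Qed.

End principal_value.

(** * Integration against a density *)

Section density.
Context {R : realType}.
Local Notation lam := (@lebesgue_measure R).
Local Notation C := (@circle R).
Variables (mu : probability (measurableTypeR R) R) (rho : R -> R).
Hypotheses (drho : is_density mu rho) (rho0 : forall x, C x -> 0 <= rho x).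

Let mC := @measurable_circle R.

Let mrho : measurable_fun setT rho.
Proof. by have [cr _ _] := drho; exact: continuous_measurable_fun. Qed.

Let muE (A : set (measurableTypeR R)) : measurable A ->
  mu A = (\int[lam]_(x in A `&` C) (rho x)%:E)%E.
Proof. by have [_ _] := drho; apply. Qed.

Let mu_dom : mu `<< lam.
Proof.
apply/null_content_dominatesP => A mA A0; rewrite muE//.
have mAC : measurable (A `&` C : set (measurableTypeR R)) by exact: measurableI.
apply: null_set_integral => //.
  by apply/measurable_EFinP; exact: measurable_funTS mrho.
by apply: (subset_measure0 mAC mA _ A0); exact: subIsetl.
Qed.

(** Both functions have the same integral, mu E, over every measurable
   subset E of the torus. *)
Let radon_nikodym_density :
  ae_eq lam C (Radon_Nikodym_SigmaFinite.f mu lam) (EFin \o rho).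
Proof.
apply: integral_ae_eq => //.
- by apply: (integrableS measurableT) => //; exact: Radon_Nikodym_SigmaFinite.f_integrable.
- by apply/measurable_EFinP; exact: measurable_funTS mrho.
- move=> E EC mE; rewrite -Radon_Nikodym_SigmaFinite.f_integral//.
  by have := muE mE; rewrite (setIidl EC).
Qed.

Let ge0_integral_density (f : R -> \bar R) : measurable_fun C f ->
  (forall x, C x -> 0 <= f x)%E ->
  (\int[mu]_(x in C) f x = \int[lam]_(x in C) (f x * (rho x)%:E))%E.
Proof.
move=> mf f0.
have f0' x : (0 <= (f \_ C) x)%E by rewrite patchE; case: ifPn => // /set_mem; exact: f0.
have mf' : measurable_fun C (f \_ C).
  by apply: eq_measurable_fun mf => x xC; rewrite patchE xC.
transitivity (\int[mu]_(x in C) (f \_ C) x)%E.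
  by apply: eq_integral => x xC; rewrite patchE xC.
rewrite -(Radon_Nikodym_SigmaFinite.change_of_variables mu_dom f0' mC mf').
apply: ae_eq_integral => //.
- apply: emeasurable_funM => //.
  apply: measurable_funTS; apply: measurable_int.
  exact: Radon_Nikodym_SigmaFinite.f_integrable.
- by apply: emeasurable_funM => //; apply/measurable_EFinP; exact: measurable_funTS mrho.
have aeF := ae_filter_ringOfSetsType lam.
apply: filterS radon_nikodym_density => x h xC.
by rewrite patchE mem_set// h.
Qed.

Lemma Rint_density (f : R -> R) : measurable_fun C f ->
  \int[mu]_(x in C) f x = \int[lam]_(x in C) (f x * rho x).
Proof.
move=> mf; congr fine; rewrite integralE [RHS]integralE.
have mf' : measurable_fun C (EFin \o f) by exact/measurable_EFinP.
congr (_ - _)%E.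
- rewrite (@ge0_integral_density (EFin \o f)^\+%E); last 2 first.
  + exact: measurable_funepos.
  + by move=> x _; exact: funepos_ge0.
  apply: eq_integral => x /set_mem xC; rewrite !funeposE/=.
  by rewrite maxe_pMl ?mul0e ?EFinM// lee_fin rho0.
- rewrite (@ge0_integral_density (EFin \o f)^\-%E); last 2 first.
  + exact: measurable_funeneg.
  + by move=> x _; exact: funeneg_ge0.
  apply: eq_integral => x /set_mem xC; rewrite !funenegE/=.
  by rewrite maxe_pMl ?mul0e ?muleN -?EFinN -?EFinM ?mulNr// lee_fin rho0.
Qed.

End density.

(** * The energy identity *)

Section variance_estimate.
Context {R : realType}.
Local Notation lam := (@lebesgue_measure R).
Local Notation C := (@circle R).
Local Notation itg f := (lam.-integrable C (EFin \o f)).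
Local Notation L2 := (sqint lam C).

Let mC := @measurable_circle R.
Let fC := @circle_fin R.
Let aeF := ae_filter_ringOfSetsType lam.

(** 2 sum_{k <= n} k |psi_k|^2, where |psi_k|^2 = (a_k^2 + b_k^2) / (4 pi^2). *)
Definition half_energy (f : R -> R) (n : nat) : R :=
  (2 * pi ^+ 2)^-1 * \sum_(1 <= k < n.+1) k%:R * (ccoef f k ^+ 2 + scoef f k ^+ 2).

Lemma coefB_cst (f : R -> R) (c : R) (k : nat) : L2 f -> (0 < k)%N ->
  ccoef (fun x => f x - c) k = ccoef f k /\ scoef (fun x => f x - c) k = scoef f k.
Proof.
move=> f2 k0; have fi := sqint_itg mC fC f2; have ci := itg_cst mC fC c.
have ic : itg (fun t => cos (k%:R * t)) by apply: sqint_itg => //; exact: sqint_cosk.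
have is' : itg (fun t => sin (k%:R * t)) by apply: sqint_itg => //; exact: sqint_sink.
rewrite ccoefB// scoefB// [X in _ - X]/ccoef [X in _ /\ _ - X = _]/scoef !RintegralZl//.
by rewrite Rint_cosk// Rint_sink mulr0 !subr0.
Qed.

Lemma Rint_trig_poly (a b : nat -> R) n : \int[lam]_(x in C) trig_poly a b n x = 0.
Proof.
have := @trig_poly_inner R a b n _ (sqint_cst mC fC 1).
under eq_Rintegral do rewrite mulr1.
move=> ->; rewrite big1_seq ?mulr0// => k; rewrite mem_index_iota => /= /andP[k0 _].
rewrite (_ : ccoef _ k = 0); last first.
  by rewrite -[RHS](@Rint_cosk R k k0); apply: eq_Rintegral => x _; rewrite mul1r.
rewrite (_ : scoef _ k = 0) ?mulr0 ?addr0//.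
by rewrite -[RHS](@Rint_sink R k); apply: eq_Rintegral => x _; rewrite mul1r.
Qed.

(** The equation v / rho + 2 pi beta H u = - Psi + c for u = rho phi' and
   v = u'. The weight 1 / rho is written w^2, to be shared between the two
   factors in the Cauchy-Schwarz inequality. *)
Section energy.
Variables (beta c m B : R) (u v w Psi f1 : R -> R).
Hypotheses (beta0 : 0 < beta) (m0 : 0 < m).
Hypotheses (pu : primitive u v) (cu : equal_ends u).
Hypotheses (pPsi : primitive Psi f1) (cPsi : equal_ends Psi).
Hypotheses (mw : measurable_fun C w) (wB : forall x, C x -> `|w x| <= B).
Hypothesis wm : {ae lam, forall x, C x -> w x ^+ 2 <= m^-1}.
Hypothesis equation : {ae lam, forall x, C x ->
  v x * w x ^+ 2 = - (2 * pi * beta * conjugate u x) - Psi x + c}.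

Let v2 : L2 v. Proof. by case: pu. Qed.
Let f12 : L2 f1. Proof. by case: pPsi. Qed.
Let Psi2 : L2 Psi. Proof. exact: primitive_sqint pPsi. Qed.
Let conj2 : L2 (conjugate u). Proof. exact: sqint_conjugate pu cu. Qed.
Let sqint_w (h : R -> R) : L2 h -> L2 (fun x => h x * w x).
Proof. by move=> h2; exact: (sqintMb mC h2 mw wB). Qed.

Let equation_tested (h : R -> R) : L2 h ->
  \int[lam]_(x in C) ((h x * w x) * (v x * w x)) =
  - (2 * pi * beta * \int[lam]_(x in C) (conjugate u x * h x)) -
  \int[lam]_(x in C) (Psi x * h x) + c * \int[lam]_(x in C) h x.
Proof.
move=> h2.
have i1 : itg (fun x => conjugate u x * h x) by exact: sqint_itgM.
have i2 : itg (fun x => Psi x * h x) by exact: sqint_itgM.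
have i3 : itg h by exact: sqint_itg.
transitivity (\int[lam]_(x in C) (- (2 * pi * beta) * (conjugate u x * h x) +
    (-1 * (Psi x * h x) + c * h x))).
  apply: Rint_ae => //.
  - by apply: measurable_funM; apply: sqint_meas; exact: sqint_w.
  - have := itgD mC (itgZ mC (- (2 * pi * beta)) i1) (itgD mC (itgZ mC (-1) i2) (itgZ mC c i3)).
    exact: itg_meas.
  apply: (@filterS _ _ aeF) equation => x e xC.
  transitivity (h x * (v x * w x ^+ 2)); first by ring.
  by rewrite e//; ring.
rewrite RintegralD//; [|exact: itgZ|by apply: itgD => //; exact: itgZ].
rewrite RintegralD//; [|exact: itgZ|exact: itgZ].
by rewrite !RintegralZl// mulNr mulN1r addrA.
Qed.

Let s := \int[lam]_(x in C) (u x * f1 x).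

(** Test function v: the contribution of H u is nonnegative, and an
   integration by parts turns - \int Psi v into \int u Psi'. *)
Lemma weighted_energy_le : \int[lam]_(x in C) ((v x * w x) ^+ 2) <= s.
Proof.
have -> : \int[lam]_(x in C) ((v x * w x) ^+ 2) =
   \int[lam]_(x in C) ((v x * w x) * (v x * w x)).
  by apply: eq_Rintegral => x _; rewrite expr2.
rewrite (equation_tested v2) (Rint_primitive pu cu) mulr0 addr0.
have -> : \int[lam]_(x in C) (Psi x * v x) = - s.
  apply: oppr_inj; rewrite -(by_parts pPsi pu cPsi cu) opprK.
  by apply: eq_Rintegral => x _; exact: mulrC.
rewrite opprK gerDr oppr_le0; apply: mulr_ge0.
  by rewrite !mulr_ge0// ?pi_ge0// ltW.
exact: conjugate_inner_derivative_ge0 pu cu.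
Qed.

(** Test function g = H(S_n Psi'), where S_n Psi' is a partial Fourier sum.
   As H is antisymmetric with square -1, \int g H u and - \int g Psi are partial
   sums of \int u Psi' and of 2 pi times the squared H^(1/2) norm; the remaining term
   \int g v / rho is bounded by Cauchy-Schwarz and [weighted_energy_le]. *)
Lemma partial_estimate n :
  (2 * pi * (beta * (pi^-1 * \sum_(1 <= k < n.+1)
      (ccoef u k * ccoef f1 k + scoef u k * scoef f1 k)) - half_energy Psi n)) ^+ 2 <=
  (m^-1 * (pi^-1 * \sum_(1 <= k < n.+1) (ccoef f1 k ^+ 2 + scoef f1 k ^+ 2))) * s.
Proof.
pose g := trig_poly (scoef f1) (fun k => - ccoef f1 k) n.
have g2 : L2 g by exact: sqint_trig_poly.
have pi0 : pi != 0 :> R by rewrite gt_eqF// pi_gt0.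
have T1 : \int[lam]_(x in C) ((g x * w x) * (v x * w x)) =
  - (2 * pi * (beta * (pi^-1 * \sum_(1 <= k < n.+1)
      (ccoef u k * ccoef f1 k + scoef u k * scoef f1 k)) - half_energy Psi n)).
  rewrite (equation_tested g2) Rint_trig_poly mulr0 addr0.
  have -> : \int[lam]_(x in C) (conjugate u x * g x) =
      pi^-1 * \sum_(1 <= k < n.+1) (ccoef u k * ccoef f1 k + scoef u k * scoef f1 k).
    transitivity (\int[lam]_(x in C) (g x * conjugate u x)).
      by apply: eq_Rintegral => x _; exact: mulrC.
    rewrite trig_poly_inner//; congr (_ * _); apply: eq_big_nat => k /andP[k0 _].
    by have [-> ->] := conjugate_coef pu cu k0; ring.
  have -> : \int[lam]_(x in C) (Psi x * g x) = - (2 * pi * half_energy Psi n).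
    transitivity (\int[lam]_(x in C) (g x * Psi x)).
      by apply: eq_Rintegral => x _; exact: mulrC.
    rewrite trig_poly_inner//.
    rewrite (_ : 2 * pi * half_energy Psi n = pi^-1 * \sum_(1 <= k < n.+1)
        k%:R * (ccoef Psi k ^+ 2 + scoef Psi k ^+ 2)); last first.
      rewrite /half_energy; move: (\sum_(_ <= _ < _) _) => S.
      by move: (pi : R) pi0 => z z0; field.
    rewrite -mulrN -sumrN; congr (_ * _); apply: eq_bigr => k _.
    by rewrite (ccoef_primitive k pPsi cPsi) (scoef_primitive k pPsi cPsi); ring.
  by ring.
rewrite -[X in X <= _]sqrrN -T1.
apply: (le_trans (cauchy_schwarz mC (sqint_w g2) (sqint_w v2))).
apply: ler_pM; [exact: Rint_sqr_ge0|exact: Rint_sqr_ge0| |exact: weighted_energy_le].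
have -> : pi^-1 * \sum_(1 <= k < n.+1) (ccoef f1 k ^+ 2 + scoef f1 k ^+ 2) =
    \int[lam]_(x in C) (g x ^+ 2).
  rewrite trig_poly_sqnorm; congr (_ * _); apply: eq_bigr => k _.
  by rewrite sqrrN addrC.
have ig : itg (fun x => g x ^+ 2) by case: g2.
rewrite -RintegralZl//.
have -> : \int[lam]_(x in C) ((g x * w x) ^+ 2) =
   \int[lam]_(x in C) (Num.min (w x ^+ 2) m^-1 * g x ^+ 2).
  apply: Rint_ae => //.
  - by apply: measurable_funX; apply: sqint_meas; exact: sqint_w.
  - apply: measurable_funM; last by apply: measurable_funX; case: g2.
    by apply: measurable_minr => //; exact: measurable_funX.
  by apply: (@filterS _ _ aeF) wm => x h xC; rewrite min_l ?h// exprMn mulrC.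
apply: le_Rintegral => //.
- apply: (@itg_le _ _ _ _ _ mC _ (fun x => m^-1 * g x ^+ 2)); last exact: itgZ.
    apply: measurable_funM; last by apply: measurable_funX; case: g2.
    by apply: measurable_minr => //; exact: measurable_funX.
  move=> x xC; rewrite ger0_norm; last first.
    by rewrite mulr_ge0 ?sqr_ge0// le_min sqr_ge0 invr_ge0 ltW.
  by rewrite ler_wpM2r ?sqr_ge0// ge_min lexx orbT.
- exact: itgZ.
- by move=> x xC; rewrite ler_wpM2r ?sqr_ge0// ge_min lexx orbT.
Qed.

End energy.

End variance_estimate.

(** * Asymptotics of the variance *)

Section asymptotics.
Context {R : realType}.
Local Notation lam := (@lebesgue_measure R).
Local Notation C := (@circle R).
Local Notation itg f := (lam.-integrable C (EFin \o f)).
Local Notation L2 := (sqint lam C).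

Let mC := @measurable_circle R.
Let fC := @circle_fin R.
Let aeF := ae_filter_ringOfSetsType lam.
Let pi_neq0 : pi != 0 :> R. Proof. by rewrite gt_eqF// pi_gt0. Qed.

(** k |f_k|^2 <= k^2 |f_k|^2, which is summable by the Bessel inequality
   for the derivative of f. *)
Lemma half_energy_cvg (f g : R -> R) : L2 f -> L2 g -> weak_derivative f g ->
  cvgn (half_energy f).
Proof.
move=> f2 g2 fg; apply: nondecreasing_is_cvgn.
  apply/nondecreasing_seqP => n; rewrite /half_energy [in leRHS]big_nat_recr//= mulrDr lerDl.
  rewrite mulr_ge0//; first by rewrite invr_ge0 mulr_ge0// sqr_ge0.
  by rewrite mulr_ge0// addr_ge0// sqr_ge0.
exists ((2 * pi)^-1 * \int[lam]_(x in C) (g x ^+ 2)) => _ [n _ <-].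
have := bessel n g2; set S := \sum_(_ <= _ < _) _ => h.
rewrite /half_energy.
have -> : (2 * pi ^+ 2)^-1 = (2 * pi)^-1 * pi^-1 :> R.
  by move: (pi : R) pi_neq0 => z z0; field.
rewrite -mulrA; apply: ler_wpM2l; first by rewrite invr_ge0 mulr_ge0// pi_ge0.
apply: le_trans h; apply: ler_wpM2l; first by rewrite invr_ge0 pi_ge0.
apply: ler_sum_nat => k /andP[k0 _].
have [-> ->] := weak_derivative_coef k f2 g2 fg.
rewrite sqrrN !exprMn -mulrDr addrC; apply: ler_wpM2r; first by rewrite addr_ge0// sqr_ge0.
by rewrite -natrX ler_nat -{1}(expn1 k) leq_pexp2l.
Qed.

Lemma sobolev_half_sqnormE (f g : R -> R) : L2 f -> L2 g -> weak_derivative f g ->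
  sobolev_half_sqnorm f = (limn (half_energy f))%:E.
Proof.
move=> f2 g2 fg; have fi := sqint_itg mC fC f2.
have cv := half_energy_cvg f2 g2 fg.
have term k : k%:R * (fourier_re f k ^+ 2 + fourier_im f k ^+ 2) =
    (4 * pi ^+ 2)^-1 * (k%:R * (ccoef f k ^+ 2 + scoef f k ^+ 2)).
  rewrite /fourier_re /fourier_im !RintegralZr//; [|exact: itgM_sink|exact: itgM_cosk].
  rewrite -/(ccoef f k) -/(scoef f k) sqrrN; move: (ccoef f k) (scoef f k) => a b.
  by move: (pi : R) pi_neq0 => z z0; field.
rewrite /sobolev_half_sqnorm.
set u := (fun n => \sum_(1 <= k < n)
   (k%:R * (fourier_re f k ^+ 2 + fourier_im f k ^+ 2))%:E)%E.
have cu : u n @[n --> \oo] --> (2^-1 * limn (half_energy f))%:E.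
  rewrite -(cvg_shiftS u).
  have -> : (fun n => u n.+1) = EFin \o (fun n => 2^-1 * half_energy f n).
    apply/funext => n; rewrite /u /= sumEFin /half_energy; congr EFin.
    under eq_bigr do rewrite term.
    rewrite -mulr_sumr; move: (\sum_(_ <= _ < _) _) => S.
    by move: (pi : R) pi_neq0 => z z0; field.
  apply: cvg_EFin; first by near=> n.
  by apply: cvgM; [exact: cvg_cst|exact: cv].
rewrite (cvg_lim _ cu)// -EFinM; congr EFin.
by rewrite mulrA divff ?mul1r.
Unshelve. all: by end_near. Qed.

Lemma sqint_ln_density (rho : R -> R) (m : R) : continuous rho -> 0 < m ->
  (forall x, C x -> m <= rho x) -> L2 (fun x => ln (rho x)).
Proof.
move=> cr m0 mr; have pi0 := @pi_gt0 R.
have [||c _ cM] := @EVT_max _ rho (- pi) pi; first by lra.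
  exact: continuous_subspaceT.
apply: (sqint_bnd mC fC (M := `|ln m| + `|ln (rho c)|)).
  apply: (measurableT_comp (@measurable_ln R)).
  by apply: measurable_funTS; exact: continuous_measurable_fun.
move=> x xC; have h1 := mr _ xC; have h2 := cM _ (in_circle_cc xC).
have r0 : 0 < rho x by exact: lt_le_trans h1.
have l1 : ln m <= ln (rho x) by rewrite ler_ln ?posrE.
have l2 : ln (rho x) <= ln (rho c) by rewrite ler_ln ?posrE// (lt_le_trans r0).
rewrite ler_norml; apply/andP; split.
- have := ler_norm (- ln m); rewrite normrN; have := normr_ge0 (ln (rho c)); lra.
- have := ler_norm (ln (rho c)); have := normr_ge0 (ln m); lra.
Qed.

(** The number s is \int u psi' for u = rho phi', an absolutely continuous
   function because rho is the exponential of one; [partial_estimate] holds for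
   every n, and its limit is the claim. *)
Lemma variance_estimate (beta m : R)
    (mu : probability (measurableTypeR R) R) (rho psi psi1 : R -> R) (s : R) :
  0 < beta -> 0 < m -> is_density mu rho -> (forall x, C x -> m <= rho x) ->
  L2 psi -> L2 psi1 -> weak_derivative psi psi1 -> is_sigma2 beta mu rho psi s ->
  0 <= s /\
  (2 * pi * (beta * s - limn (half_energy psi))) ^+ 2 <=
    m^-1 * \int[lam]_(x in C) (psi1 x ^+ 2) * s.
Proof.
move=> beta0 m0 drho mr psi2 psi12 wpsi.
move=> [phi [[Hf Hphi [phi1 [phi2 [l1 [[p12 wp1] [p22 wp2] [l12 wl] eqn]]]]]
  [f1 [g1 [f12 g12 wf wg sE]]]]].
have [cr _ _] := drho.
have r0 x : C x -> 0 < rho x by move=> /mr; exact: lt_le_trans.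
set a := \int[mu]_(y in C) psi y in Hf wf eqn.
have F2 : L2 (centered mu psi).
  by case: Hf => [[d [<- dL _]] _]; exact: (dL 0%N).
have phiL2 : L2 phi by case: Hphi => [[d [<- dL _]] _]; exact: (dL 0%N).
have ln2 := sqint_ln_density cr m0 mr.
have [Psi [pPsi cPsi ePsi]] := weak_derivative_primitive F2 f12 wf.
have [Phi [pPhi cPhi ePhi]] := weak_derivative_primitive p12 p22 wp2.
have [La [pLa cLa eLa]] := weak_derivative_primitive ln2 l12 wl.
have pE := primitive_expR pLa.
have pu := primitiveM pE pPhi.
set u := (fun x => expR (La x) * Phi x) in pu.
set v := (fun x => l1 x * expR (La x) * Phi x + expR (La x) * phi2 x) in pu.
have cu : equal_ends u by rewrite /equal_ends /u cLa cPhi.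
have erho : {ae lam, forall x, C x -> rho x = expR (La x)}.
  by apply: (@filterS _ _ aeF) eLa => x h xC; rewrite -h// lnK// posrE r0.
have eu : {ae lam, forall x, C x -> rho x * phi1 x = u x}.
  by apply: (@filterS2 _ _ aeF) erho ePhi => x h1 h2 xC; rewrite /u h1// h2.
have mrho : measurable_fun C rho.
  by apply: measurable_funTS; exact: continuous_measurable_fun.
have mrp : measurable_fun C (fun t => rho t * phi1 t).
  by apply: measurable_funM => //; case: p12.
(* w = rho^(-1/2) almost everywhere *)
pose w x := expR (- 2^-1 * La x).
have pw := primitive_expR (primitiveZ (- 2^-1) pLa).
have mw : measurable_fun C w by exact: primitive_measurable pw.
have [B wB'] := primitive_bounded pw.
have wB x : C x -> `|w x| <= B by move=> xC; apply: wB'; exact: in_circle_cc.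
have w2 x : w x ^+ 2 = (expR (La x))^-1.
  by rewrite /w expr2 -expRD -expRN; congr expR; field.
have wm : {ae lam, forall x, C x -> w x ^+ 2 <= m^-1}.
  apply: (@filterS _ _ aeF) erho => x h xC.
  by rewrite w2 -h// lef_pV2 ?posrE ?r0// mr.
have equation : {ae lam, forall x, C x -> v x * w x ^+ 2 =
   - (2 * pi * beta * conjugate u x) - Psi x +
   - \int[mu]_(y in C) generator beta rho phi1 phi2 l1 y}.
  apply: (@filterS3 _ _ aeF) eqn ePhi ePsi => x h1 h2 h3 xC.
  have := h1 xC; rewrite {1}/centered {1}/generator (hilbert_transformE pu cu mrp eu xC).
  rewrite h2// h3// w2 => <-; rewrite /v; field.
  by rewrite gt_eqF// expR_gt0.
have eg : {ae lam, forall x, C x -> g1 x = phi1 x}.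
  exact: weak_derivative_unique phiL2 g12 p12 wg wp1.
have sE' : s = \int[lam]_(x in C) (u x * f1 x).
  rewrite sE (Rint_density drho); last 2 first.
  - by move=> x xC; rewrite ltW// r0.
  - by apply: measurable_funM; [case: f12|case: g12].
  apply: Rint_ae => //.
  - by apply: measurable_funM => //; apply: measurable_funM; [case: f12|case: g12].
  - by apply: measurable_funM; [exact: primitive_measurable pu|case: f12].
  apply: (@filterS2 _ _ aeF) eg eu => x h1 h2 xC.
  by rewrite h1// -h2//; ring.
have wen := weighted_energy_le beta0 pu cu pPsi cPsi mw wB equation.
rewrite -sE' in wen.
have s0 : 0 <= s by apply: le_trans wen; exact: Rint_sqr_ge0.
split=> //.
have part n := partial_estimate beta0 m0 pu cu pPsi cPsi mw wB wm equation n.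
rewrite -sE' in part.
have Fk k : (0 < k)%N -> ccoef (centered mu psi) k = ccoef psi k /\
    scoef (centered mu psi) k = scoef psi k by exact: coefB_cst.
have Pk k : ccoef Psi k = ccoef (centered mu psi) k /\ scoef Psi k = scoef (centered mu psi) k.
  have PL2 := primitive_sqint pPsi.
  split; apply: Rint_ae => //.
  - by apply: measurable_funM; [case: PL2|exact: meas_cosk].
  - by apply: measurable_funM; [case: F2|exact: meas_cosk].
  - by apply: (@filterS _ _ aeF) ePsi => x h xC; rewrite h.
  - by apply: measurable_funM; [case: PL2|exact: meas_sink].
  - by apply: measurable_funM; [case: F2|exact: meas_sink].
  - by apply: (@filterS _ _ aeF) ePsi => x h xC; rewrite h.
have hE n : half_energy Psi n = half_energy psi n.
  congr (_ * _); apply: eq_big_nat => k /andP[k0 _].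
  by have [-> ->] := Pk k; have [-> ->] := Fk k k0.
have fk k : (0 < k)%N -> ccoef f1 k = ccoef psi1 k /\ scoef f1 k = scoef psi1 k.
  move=> k0; have [-> ->] := weak_derivative_coef k F2 f12 wf.
  have [-> ->] := weak_derivative_coef k psi2 psi12 wpsi.
  by have [-> ->] := Fk k k0.
have int_f1 : \int[lam]_(x in C) f1 x = 0.
  by rewrite -ccoef0 (proj1 (weak_derivative_coef 0 F2 f12 wf)) mul0r.
have par := parseval pu cu f12 int_f1; rewrite -sE' in par.
have cvh := half_energy_cvg psi2 psi12 wpsi.
set S := (fun n => pi^-1 * _) in par.
have cvd : 2 * pi * (beta * S n - half_energy psi n) @[n --> \oo] -->
    2 * pi * (beta * s - limn (half_energy psi)).
  by apply: cvgM; [exact: cvg_cst|apply: cvgB => //; apply: cvgM => //; exact: cvg_cst].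
have cvq : (2 * pi * (beta * S n - half_energy psi n)) ^+ 2 @[n --> \oo] -->
    (2 * pi * (beta * s - limn (half_energy psi))) ^+ 2 by exact: cvgM.
rewrite -(cvg_lim (@norm_hausdorff _ _) cvq).
apply: limr_le; first by apply/cvg_ex; eexists; exact: cvq.
near=> n; have := part n; rewrite hE expr2 => /le_trans; apply.
apply: ler_wpM2r => //; apply: ler_wpM2l; first by rewrite invr_ge0 ltW.
apply: le_trans (bessel n psi12); rewrite le_eqVlt; apply/orP; left; apply/eqP.
congr (_ * _); apply: eq_big_nat => k /andP[k0 _].
by have [-> ->] := fk k k0.
Unshelve. all: by end_near. Qed.

(** The infimum of a set that has none is 0, so that a positive value is a
   genuine lower bound. *)
Lemma circle_min_le (rho : R -> R) : 0 < circle_min rho ->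
  forall x, C x -> circle_min rho <= rho x.
Proof.
rewrite /circle_min => i0 x xC.
have hi : has_inf (rho @` C).
  by apply: contrapT => /inf_out h; rewrite h ltxx in i0.
by apply: ge_inf; [case: hi|exists x].
Qed.

(** Here t stands for |X - N|, n for |N|: a bound of t^2 A by K X is a quadratic
   inequality in t, which fails for t >= e once A is large. *)
Lemma self_bound_absurd (K n e t A X : R) : 0 <= K -> 0 <= n -> 0 < e -> e <= t ->
  X <= n + t -> t ^+ 2 * A <= K * X -> (A - 1) * e ^+ 2 = 2 * (K + 1) * (n + e + 1) ->
  False.
Proof.
move=> K0 n0 e0 et XN q hA; have t0 : 0 < t by exact: lt_le_trans et.
pose M := 2 * (K + 1) * (n + e + 1).
have M0 : 0 <= M by rewrite /M !mulr_ge0//; lra.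
have h1 : t ^+ 2 * A <= K * (n + t) by apply: (le_trans q); rewrite ler_wpM2l.
have h2 : t ^+ 2 * M <= K * (n + t) * e ^+ 2.
  apply: (@le_trans _ _ (t ^+ 2 * A * e ^+ 2)); last by rewrite ler_wpM2r ?sqr_ge0.
  rewrite -mulrA ler_wpM2l ?sqr_ge0// /M -hA ler_wpM2r ?sqr_ge0//; lra.
have te0 : 0 < t * e by rewrite mulr_gt0.
have h3 : t * e * M <= t ^+ 2 * M by rewrite expr2 ler_wpM2r// ler_wpM2l// ltW.
have h4 : K * (n + t) * e ^+ 2 <= t * e * (K * (n + e)).
  rewrite (_ : t * e * (K * (n + e)) = K * e * (t * (n + e))); last by ring.
  rewrite (_ : K * (n + t) * e ^+ 2 = K * e * (e * (n + t))); last by ring.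
  rewrite ler_wpM2l//; first by rewrite mulr_ge0// ltW.
  by rewrite !mulrDr (mulrC e t) lerD2r ler_wpM2r.
have : t * e * M <= t * e * (K * (n + e)) by lra.
rewrite ler_pM2l// /M leNgt => /negP; apply.
have := mulr_ge0 K0 n0; have := mulr_ge0 K0 (ltW e0).
by move=> ? ?; lra.
Qed.

(** With X = beta sigma^2 and N the squared H^(1/2) norm, [variance_estimate]
   reads (X - N)^2 <= K X / (beta min rho), where K depends on psi only. *)
Lemma variance_cvg (mu : R -> probability (measurableTypeR R) R) (rho : R -> R -> R) :
  (forall beta : R, 0 < beta -> is_density (mu beta) (rho beta)) ->
  beta * circle_min (rho beta) @[beta --> +oo] --> +oo ->
  forall psi : R -> R, sobolev 2 psi ->
  forall sigma2 : R -> R,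
  (forall beta : R, 0 < beta -> is_sigma2 beta (mu beta) (rho beta) psi (sigma2 beta)) ->
  (beta * sigma2 beta)%:E @[beta --> +oo] --> sobolev_half_sqnorm psi.
Proof.
move=> drho min_cvg psi [d [d0 dL dw]] sigma2 hs.
have psi2 : L2 psi by rewrite -d0; exact: (dL 0%N).
have psi12 : L2 (d 1%N) by exact: (dL 1%N).
have wpsi : weak_derivative psi (d 1%N) by rewrite -d0; exact: (dw 0%N).
rewrite (sobolev_half_sqnormE psi2 psi12 wpsi).
set N := limn _; set P := \int[lam]_(x in C) (d 1%N x ^+ 2).
have P0 : 0 <= P by exact: Rint_sqr_ge0.
apply: cvg_EFin; first by near=> b.
apply/cvgrPdist_lt => e e0.
pose K := P / (2 * pi) ^+ 2.
have pp : 0 < (2 * pi) ^+ 2 :> R by rewrite exprn_gt0// mulr_gt0// pi_gt0.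
have K0 : 0 <= K by rewrite divr_ge0// ltW.
(* the threshold on beta min rho that [self_bound_absurd] contradicts *)
pose A := 2 * (K + 1) * (`|N| + e + 1) / e ^+ 2 + 1.
near=> b.
have b0 : 0 < b by near: b; exact: nbhs_pinfty_gt.
have Ab : A < b * circle_min (rho b).
  by near: b; move/cvgryPgt : min_cvg; apply.
have A1 : 1 <= A.
  by rewrite lerDr divr_ge0 ?sqr_ge0// mulr_ge0// ?mulr_ge0// ?addr_ge0// ltW.
have m0 : 0 < circle_min (rho b) by rewrite -(pmulr_rgt0 _ b0); lra.
have [s0 h] := variance_estimate b0 m0 (drho b b0) (circle_min_le m0) psi2 psi12 wpsi (hs b b0).
set X := b * sigma2 b; rewrite -/X -/N -/P in h.
have X0 : 0 <= X by rewrite mulr_ge0// ltW.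
have {}h : (X - N) ^+ 2 * (b * circle_min (rho b)) <= K * X.
  rewrite exprMn mulrC -ler_pdivlMr// in h.
  have bm0 : 0 <= b * circle_min (rho b) by rewrite mulr_ge0// ltW.
  apply: (le_trans (ler_wpM2r bm0 h)).
  rewrite /K /X le_eqVlt; apply/orP; left; apply/eqP.
  move: m0 pp; move: (circle_min _) ((2 * pi) ^+ 2) => m q m0 q0.
  by field; rewrite !gt_eqF.
have {}h : (X - N) ^+ 2 * A <= K * X.
  by apply: le_trans h; rewrite ler_wpM2l ?sqr_ge0// ltW.
rewrite distrC ltNge; apply/negP => eX.
have hA : (A - 1) * e ^+ 2 = 2 * (K + 1) * (`|N| + e + 1).
  by rewrite addrK divfK// gt_eqF// exprn_gt0.
have q : `|X - N| ^+ 2 * A <= K * X by rewrite real_normK ?num_real.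
have XN : X <= `|N| + `|X - N|.
  by rewrite -{1}(subrK N X) addrC lerD// ler_norm.
exact: (self_bound_absurd K0 (normr_ge0 N) e0 eX XN q hA).
Unshelve. all: by end_near. Qed.

End asymptotics.

Theorem proposition8p3 (R : realType) (V : R -> R) (hV : C11 V) :
  (forall (mu : R -> probability (measurableTypeR R) R) (rho : R -> R -> R),
     (forall beta : R, 0 < beta -> is_equilibrium beta V (mu beta)) ->
     (forall beta : R, 0 < beta -> is_density (mu beta) (rho beta)) ->
     beta * circle_min (rho beta) @[beta --> +oo] --> +oo ->
     forall psi : R -> R, sobolev 2 psi ->
     forall sigma2 : R -> R,
     (forall beta : R, 0 < beta ->
        is_sigma2 beta (mu beta) (rho beta) psi (sigma2 beta)) ->
     (beta * sigma2 beta)%:E @[beta --> +oo] --> sobolev_half_sqnorm psi)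
  /\
  (forall (mu : R -> probability (measurableTypeR R) R) (rho : R -> R -> R),
     (forall beta : R, 0 < beta ->
        is_equilibrium beta (fun x => beta * V x) (mu beta)) ->
     (forall beta : R, 0 < beta -> is_density (mu beta) (rho beta)) ->
     beta * circle_min (rho beta) @[beta --> +oo] --> +oo ->
     forall psi : R -> R, sobolev 2 psi ->
     forall sigma2 : R -> R,
     (forall beta : R, 0 < beta ->
        is_sigma2 beta (mu beta) (rho beta) psi (sigma2 beta)) ->
     (beta * sigma2 beta)%:E @[beta --> +oo] --> sobolev_half_sqnorm psi).
Proof.
split=> mu rho _ drho mrho psi hpsi sigma2 hs.
- exact: variance_cvg drho mrho psi hpsi sigma2 hs.
- exact: variance_cvg drho mrho psi hpsi sigma2 hs.
Qed.
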